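(* Given $U\in\mathbb{R}^{m\times m}$ of rank $k$, for every $r\in[k]$ the $\binom{k}{r}$ critical points of $d_U$ on $\mathcal{X}_r$ span an affine hyperplane $W_{U,r}\subset H_U$ of equation $$W_{U,r}\colon\ \langle X,C(U)\rangle_F-r\det(U)=0.$$ In particular, if $\det(U)\neq 0$, then $\{W_{U,r}\}_{r\in[m]}$ is a finite family of parallel hyperplanes contained in $H_U$. Otherwise, if $\det(U)=0$, then $W_{U,r}$ is a linear hyperplane whose equation does not depend on the rank $r$.
   Context: This is the square, unstructured case ($m=n$, no prescribed zeros). Notation: $[k]=\{1,\dots,k\}$; $\langle A,B\rangle_F=\mathrm{trace}(AB^T)$; $\mathcal{X}_r\subset\mathbb{C}^{m\times m}$ is the variety of matrices of rank at most $r$; $d_U(X)=\sum_{i,j}(x_{ij}-u_{ij})^2$. A critical point of $d_U$ on $\mathcal{X}_r$ is a smooth point $X\in\mathcal{X}_r$ such that $U-X$ is orthogonal to the tangent space $T_X\mathcal{X}_r$ with respect to $\langle\cdot,\cdot\rangle_F$. $C(U)$ is the cofactor matrix of $U$, whose $(i,j)$-th entry is $(-1)^{i+j}M_{[m]\setminus\{i\},[m]\setminus\{j\}}(U)$, where $M_{I,J}(U)$ is the minor of $U$ with rows $I$ and columns $J$. The critical space $H_U\subset\mathbb{C}^{m\times m}$ is the linear space of matrices $X$ satisfying $(XU^T-UX^T)_{ij}=0$ and $(X^TU-U^TX)_{ij}=0$ for all $i,j\in[m]$. The hyperplane $W_{U,r}$ is a hyperplane of $H_U$, i.e. the displayed equation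 is imposed on $X\in H_U$. Background (Eckart-Young-Mirsky): if $U=A\Sigma B^T$ is a singular value decomposition of $U$ of rank $k$, the critical points of $d_U$ on $\mathcal{X}_r$ are the matrices $A(\Sigma_{i_1}+\cdots+\Sigma_{i_r})B^T$ for $\{i_1<\cdots<i_r\}\subset[k]$, where $\Sigma_j$ is the matrix whose only non-zero entry is the $(j,j)$ entry $\sigma_j$; there are $\binom{k}{r}$ of them when the non-zero singular values of $U$ are distinct.
   Formalization: The count is claimed only for distinct nonzero singular values and k≥m−1; W is called a hyperplane only if k≥m−1; if k≥m−1, spanning excludes r=k≥2 (there U is the only critical point); if det(U)=0, ''span'' means linear span. *)

(* Defs.v *)
From HB Require Import structures.
From mathcomp Require Import all_boot all_order all_algebra.
From mathcomp Require Import complex mpoly.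
From mathcomp Require Import boolp classical_sets functions cardinality reals.

Set Implicit Arguments.
Unset Strict Implicit.
Unset Printing Implicit Defensive.

Import Order.TTheory GRing.Theory Num.Theory.

Local Open Scope ring_scope.
Local Open Scope classical_set_scope.

Section Spans.
Variables (F : fieldType) (V : lmodType F).
Implicit Type S : set V.

Definition linear_span S : set V :=
  [set v | exists (n : nat) (x : 'I_n -> V) (a : 'I_n -> F),
      (forall i, S (x i)) /\ v = \sum_i a i *: x i].

Definition affine_span S : set V :=
  [set v | exists (n : nat) (x : 'I_n -> V) (a : 'I_n -> F),
      [/\ forall i, S (x i), \sum_i a i = 1 & v = \sum_i a i *: x i]].

End Spans.

Section Hyperplanes.
Variables (F : fieldType) (V : vectType F).
Implicit Types H W : set V.

Definition is_linear_hyperplane H W : Prop :=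
  exists E D : {vspace V},
    [/\ H = [set x | x \in E], (D <= E)%VS, \dim E = (\dim D).+1
      & W = [set x | x \in D]].

Definition is_affine_hyperplane H W : Prop :=
  exists (E D : {vspace V}) (x0 : V),
    [/\ H = [set x | x \in E], (D <= E)%VS, \dim E = (\dim D).+1, x0 \in E
      & W = [set x | x - x0 \in D]].

(* Translates of each other; in particular W is parallel to itself. *)
Definition parallel W1 W2 : Prop :=
  exists t : V, W2 = [set x + t | x in W1].

End Hyperplanes.

Section LowRank.
Variables (F : closedFieldType) (m : nat).
Implicit Types (U X Y Z : 'M[F]_m) (f : {mpoly F[m * m]}).

Definition frob X Y : F := \tr (X *m Y^T).

Definition rank_variety (r : nat) : set 'M[F]_m :=
  [set X | (\rank X <= r)%N].

(* The m * m variables of a polynomial are identified with the entries of a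
   matrix through mxvec. *)
Definition mx_eval f X : F := f.@[fun a => mxvec X ord0 a].

Definition mx_diff f X Y : F :=
  \sum_(a < m * m) mx_eval (mderiv a f) X * mxvec Y ord0 a.

(* Zariski tangent space at X: the common kernel of the differentials at X of
   all polynomials in the ideal of S. *)
Definition tangent_space (S : set 'M[F]_m) X : set 'M[F]_m :=
  [set Y | forall f, (forall Z, S Z -> mx_eval f Z = 0) -> mx_diff f X Y = 0].

Definition has_dim (T : set 'M[F]_m) (d : nat) : Prop :=
  exists E : {vspace 'M[F]_m}, T = [set Y | Y \in E] /\ \dim E = d.

(* Smooth points of an irreducible variety S: those at which the dimension of
   the tangent space is minimal, i.e. equal to the dimension of S.  Rank
   varieties are irreducible. *)
Definition smooth_point (S : set 'M[F]_m) X : Prop :=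
  S X /\ exists2 d, has_dim (tangent_space S X) d &
         forall Z e, S Z -> has_dim (tangent_space S Z) e -> (d <= e)%N.

(* Critical points on the rank variety of the squared distance
   d_U(X) = \sum_i \sum_j (X i j - U i j) ^+ 2. *)
Definition critical_points U (r : nat) : set 'M[F]_m :=
  [set X | smooth_point (rank_variety r) X /\
     forall Y, tangent_space (rank_variety r) X Y -> frob (U - X) Y = 0].

Definition cofactor_mx U : 'M[F]_m := \matrix_(i, j) cofactor U i j.

Definition critical_space U : set 'M[F]_m :=
  [set X | forall i j, (X *m U^T - U *m X^T) i j = 0 /\
                       (X^T *m U - U^T *m X) i j = 0].

Definition W_ U (r : nat) : set 'M[F]_m :=
  [set X | critical_space U X /\
           frob X (cofactor_mx U) - r%:R * \det U = 0].

End LowRank.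

Section Real.
Variables (R : realType) (m : nat).
Implicit Type U : 'M[R]_m.

Definition complexify U : 'M[R[i]]_m := map_mx (real_complex R) U.

(* The diagonal entries of a singular value decomposition A * diag s * B^T are
   not required to be sorted. *)
Definition is_svd U (A : 'M[R]_m) (s : 'rV[R]_m) (B : 'M[R]_m) : Prop :=
  [/\ A *m A^T = 1%:M, B *m B^T = 1%:M, forall i, 0 <= s ord0 i
    & U = A *m diag_mx s *m B^T].

Definition distinct_nonzero_singular_values U : Prop :=
  exists A s B, is_svd U A s B /\
    forall i j, s ord0 i != 0 -> s ord0 i = s ord0 j -> i = j.

End Real.

(* Main.v *)
Require Import Defs.
From HB Require Import structures.
From mathcomp Require Import all_boot all_order all_algebra.
From mathcomp Require Import complex mpoly ring.
From mathcomp Require Import boolp classical_sets functions cardinality reals.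

Set Implicit Arguments.
Unset Strict Implicit.
Unset Printing Implicit Defensive.

Import Order.TTheory GRing.Theory Num.Theory.

Local Open Scope ring_scope.
Local Open Scope classical_set_scope.

(** The statement is invariant under U |-> A U B^T for orthogonal A and B, so a
    real singular value decomposition reduces it to a diagonal matrix S with
    nonnegative entries s_i, of which k are nonzero.

    The tangent space of the rank variety at a point X of rank r consists of
    the matrices XP + QX ([tangent_rankE]), and at a point of smaller rank it is
    everything.  Hence X is critical for U exactly when it has rank r and
    X^T (U - X) = 0 = (U - X) X^T ([critical_pointsP]).

    These equations make X^T U and U X^T symmetric, which is membership in the
    critical space.  When U is invertible they also make X U^-1 idempotent of
    rank r, hence of trace r; since the transpose of C(U) is det U times U^-1,
    this is the equation of the hyperplane ([critical_eqs_unit]).  When S has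
    exactly one zero s_i, the only term left in <X, C(S)> is a multiple of
    X_ii, and the equations give X_ii ^ 2 = 0; with more zeros C(S) = 0
    ([critical_W_diag]).

    For the spans, critical points of S are assembled from blocks with disjoint
    supports ([pieceD]): multiples by t of the projection on a line contained
    in the eigenspace of a nonzero t ([piece_line]), and products of isotropic
    vectors of the kernel, which exist over the complex numbers as soon as the
    kernel has dimension two ([piece_isotropic]).  Two critical points that
    share all their blocks but one differ by the difference of the two blocks,
    and this yields the directions s_i E_ii - s_j E_jj, E_ij + E_ji for equal
    nonzero s_i = s_j, and E_pq for s_p = s_q = 0 ([direction_diag],
    [direction_sym], [direction_null]).  Elements of the critical space are
    symmetric on the blocks of equal nonzero s_i, arbitrary on the kernel and
    zero elsewhere, so these directions exhaust the hyperplane.  There is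
    nothing to exchange when r = k > 1 and the kernel is at most a line: then U
    is the only critical point, which is why this case is set apart.

    The cofactor form X |-> <X, C(U)> takes the value m det U at U, so adding
    multiples of U translates the levels W_{U,r} into one another. *)

(** * Polynomials along polynomial curves *)

Section ChainRule.
Variables (F : comNzRingType) (n : nat).
Implicit Types (f g : {mpoly F[n]}) (c : 'I_n -> {poly F}).

Definition along f c : {poly F} := mmap (@polyC F) c f.

Lemma horner_along f c t : (along f c).[t] = f.@[fun i => (c i).[t]].
Proof.
rewrite /along /meval /mmap horner_sum; apply: eq_bigr => m _.
by rewrite hornerM hornerC horner_prod; congr (_ * _); apply: eq_bigr => i _;
   rewrite horner_exp.
Qed.

(** Both sides are linear and satisfy the Leibniz rule in f, so it is enough to
    compare them on the variables. *)
Lemma deriv_along f c :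
  (along f c)^`() = \sum_(i < n) along (mderiv i f) c * (c i)^`().
Proof.
have HM f1 f2 : (along f1 c)^`() = \sum_(i < n) along (mderiv i f1) c * (c i)^`() ->
    (along f2 c)^`() = \sum_(i < n) along (mderiv i f2) c * (c i)^`() ->
    (along (f1 * f2) c)^`() = \sum_(i < n) along (mderiv i (f1 * f2)) c * (c i)^`().
  rewrite /along rmorphM derivM => -> ->.
  rewrite mulr_suml mulr_sumr -big_split; apply: eq_bigr => i _ /=.
  by rewrite mderivM rmorphD !rmorphM mulrDl mulrAC mulrA.
elim/mpolyind: f => [|a m f _ _ IHf].
  rewrite /along rmorph0 deriv0 big1 // => i _.
  by rewrite mderiv0 rmorph0 mul0r.
rewrite /along rmorphD derivD IHf /=.
rewrite mmapZ derivM derivC mul0r add0r.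
have -> : (mmap (@polyC F) c 'X_[m])^`() =
    \sum_(i < n) along (mderiv i 'X_[m]) c * (c i)^`().
  rewrite mpolyXE_id.
  apply: (big_ind (fun g => (along g c)^`() =
    \sum_(i < n) along (mderiv i g) c * (c i)^`())) => //.
    rewrite /along rmorph1 derivC big1 // => i _.
    by rewrite mderivC rmorph0 mul0r.
  move=> i _; elim: (m i) => [|k IHk].
    rewrite expr0 /along rmorph1 derivC big1 // => j _.
    by rewrite mderivC rmorph0 mul0r.
  rewrite exprS; apply: HM => //.
  rewrite /along mmapX mmap1U (bigD1 i) //= big1 ?addr0.
    by rewrite mderivX mnm1E eqxx scale1r -{1}[U_(i)%MM]add0m addmK mpolyX0 rmorph1 mul1r.
  move=> j nij; rewrite mderivX mnm1E eq_sym (negPf nij) scale0r rmorph0.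
  by rewrite mul0r.
rewrite mulr_sumr -big_split; apply: eq_bigr => i _ /=.
by rewrite mderivD mderivZ rmorphD /= mmapZ mulrDl mulrA.
Qed.

End ChainRule.

(** * Tangent spaces of rank varieties *)

Section TangentSpace.
Variables (F : numClosedFieldType) (m : nat).
Implicit Types (X Y Z U : 'M[F]_m) (f : {mpoly F[m * m]}) (c : 'M[{poly F}]_m).

Definition mx_along f c : {poly F} := along f (fun a => mxvec c ord0 a).

Definition mx_at (t : F) c : 'M[F]_m := map_mx (fun p => p.[t]) c.

Lemma horner_mx_along f c t : (mx_along f c).[t] = mx_eval f (mx_at t c).
Proof.
by rewrite horner_along /mx_eval; apply: meval_eq => a; rewrite -map_mxvec mxE.
Qed.

Lemma deriv_mx_along f c :
  (mx_along f c)^`().[0] = mx_diff f (mx_at 0 c) (mx_at 0 (map_mx (@deriv F) c)).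
Proof.
rewrite deriv_along horner_sum; apply: eq_bigr => a _.
rewrite hornerM -/(mx_along _ _) horner_mx_along; congr (_ * _).
by rewrite /mx_at -map_mxvec mxE -map_mxvec mxE.
Qed.

(** The integers are infinitely many roots in characteristic zero. *)
Lemma poly0_of_roots (R : numDomainType) (p : {poly R}) :
  (forall t, p.[t] = 0) -> p = 0.
Proof.
move=> p0; apply/eqP/negP => /negP pn0.
have := @max_poly_roots _ p [seq i%:R | i <- iota 0 (size p)] pn0.
rewrite size_map size_iota ltnn => H.
suff: false by []; apply: H; first by apply/allP => x _; apply/rootP.
by rewrite map_inj_uniq ?iota_uniq // => i j /eqP; rewrite eqr_nat => /eqP.
Qed.

(** A curve that stays in S has its velocity in the tangent space, because a
    polynomial vanishing on S vanishes identically along the curve. *)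
Lemma tangent_velocity (S : set 'M[F]_m) c :
  (forall t, S (mx_at t c)) ->
  tangent_space S (mx_at 0 c) (mx_at 0 (map_mx (@deriv F) c)).
Proof.
move=> cS f f0; rewrite -deriv_mx_along.
have -> : mx_along f c = 0.
  by apply: poly0_of_roots => t; rewrite horner_mx_along f0.
by rewrite deriv0 horner0.
Qed.

(** The minors of size r + 1 cut out the rank variety; taking them in arbitrary
    coordinates P, Q makes one of them enough to detect a given tangent
    direction. *)
Definition generic_minor q (P : 'M[F]_(q, m)) (Q : 'M[F]_(m, q)) :
    {mpoly F[m * m]} :=
  \det (map_mx (@mpolyC _ F) P *m (\matrix_(i, j) 'X_(mxvec_index i j))
        *m map_mx (@mpolyC _ F) Q).

Lemma along_generic_minor q (P : 'M[F]_(q, m)) (Q : 'M[F]_(m, q)) c :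
  mx_along (generic_minor P Q) c
    = \det (map_mx polyC P *m c *m map_mx polyC Q).
Proof.
rewrite /mx_along /along -det_map_mx !map_mxM -!map_mx_comp.
congr (\det (_ *m _ *m _)); apply/matrixP => i j; rewrite !mxE /= ?mmapC //.
by rewrite mmapX mmap1U mxvecE.
Qed.

Lemma eval_generic_minor q (P : 'M[F]_(q, m)) (Q : 'M[F]_(m, q)) Z :
  mx_eval (generic_minor P Q) Z = \det (P *m Z *m Q).
Proof.
rewrite /mx_eval -det_map_mx !map_mxM -!map_mx_comp.
congr (\det (_ *m _ *m _)); apply/matrixP => i j; rewrite !mxE /= ?mevalC //.
by rewrite mevalXU mxvecE.
Qed.

Definition line X Y : 'M[{poly F}]_m := map_mx polyC X + 'X *: map_mx polyC Y.

Lemma line_at X Y t : mx_at t (line X Y) = X + t *: Y.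
Proof. by apply/matrixP=> i j; rewrite !mxE hornerD hornerM hornerX !hornerC. Qed.

Lemma deriv_line X Y : map_mx (@deriv F) (line X Y) = map_mx polyC Y.
Proof.
apply/matrixP=> i j; rewrite !mxE derivD derivM derivX !derivC.
by rewrite mul1r mulr0 addr0 add0r.
Qed.

Lemma mx_at_polyC X t : mx_at t (map_mx polyC X) = X.
Proof. by apply/matrixP=> i j; rewrite !mxE hornerC. Qed.

Lemma mxrankM_max3 p q (A : 'M[F]_(p, m)) Z (B : 'M[F]_(m, q)) :
  (\rank (A *m Z *m B) <= \rank Z)%N.
Proof. exact: leq_trans (mxrankM_maxl _ _) (mxrankM_maxr _ _). Qed.

(** Choose P = (L; u) and Q = (R, v) with L X R = 1.  The determinant of
    P Z Q has r + 1 rows, so it vanishes on the rank variety, and its first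
    order term at X in the direction Y is u Y v. *)
Lemma tangent_rank_sub (r : nat) X Y (u : 'rV_m) (v : 'cV_m) :
  \rank X = r -> tangent_space (rank_variety r) X Y ->
  u *m X = 0 -> X *m v = 0 -> u *m Y *m v = 0.
Proof.
move=> rX TY uX Xv; subst r.
pose r := \rank X.
pose L := pinvmx (col_base X); pose R := pinvmx (row_base X).
have LC : L *m col_base X = 1%:M by rewrite mulVpmx ?col_base_full.
have BR : row_base X *m R = 1%:M by rewrite mulmxVp ?row_base_free.
have LXR : L *m X *m R = 1%:M.
  by have := congr1 (mulmx L) (mulmx_base X); rewrite mulmxA LC mul1mx => <-.
pose P : 'M[F]_(r + 1, m) := col_mx L u.
pose Q : 'M[F]_(m, r + 1) := row_mx R v.
have := TY (generic_minor P Q) => H.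
have {}H : mx_diff (generic_minor P Q) X Y = 0.
  apply: H => Z /= rZ; rewrite eval_generic_minor; apply/eqP.
  rewrite -[_ == 0]negbK -unitfE -[_ \is a _]/(_ \in unitmx) -row_full_unit.
  apply/negP => /eqP rkE; have := mxrankM_max3 P Z Q; rewrite rkE.
  by move/leq_trans/(_ rZ); rewrite addn1 ltnn.
have := deriv_mx_along (generic_minor P Q) (line X Y).
rewrite line_at scale0r addr0 deriv_line mx_at_polyC H along_generic_minor.
pose M : 'M[{poly F}]_(r + 1) :=
  block_mx (1%:M + 'X *: map_mx polyC (L *m Y *m R))
           ('X *: map_mx polyC (L *m Y *m v))
           (map_mx polyC (u *m Y *m R)) (map_mx polyC (u *m Y *m v)).
(* The last row of P (X + tY) Q is divisible by t because uX = 0. *)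
have -> : map_mx polyC P *m line X Y *m map_mx polyC Q
    = block_mx 1%:M 0 0 ('X%:M) *m M.
  rewrite /line mulmxDr mulmxDl -scalemxAr -scalemxAl -!map_mxM.
  rewrite /P /Q (mul_col_mx _ _ X) (mul_col_mx _ _ Y) !mul_col_row.
  rewrite uX LXR !mul0mx -(mulmxA L X) Xv mulmx0.
  rewrite mulmx_block !map_block_mx scale_block_mx add_block_mx.
  rewrite !mul0mx !mul1mx !map_mx0 !add0r !addr0 !mul_scalar_mx.
  by rewrite map_mx1.
rewrite det_mulmx det_ublock det1 mul1r det_scalar1.
rewrite derivM derivX mul1r hornerD hornerM hornerX mul0r addr0.
have -> : (\det M).[0] = \det (map_mx (horner_eval 0) M).
  by rewrite det_map_mx.
have hC p q (A : 'M[F]_(p, q)) : map_mx (horner_eval 0) (map_mx polyC A) = A.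
  by apply/matrixP => i j; rewrite !mxE /horner_eval hornerC.
have -> : map_mx (horner_eval 0) M = block_mx 1%:M 0 (u *m Y *m R) (u *m Y *m v).
  rewrite map_block_mx !map_mxD map_mx1 !map_mxZ !hC /= /horner_eval hornerX.
  by rewrite !scale0r addr0.
by rewrite det_lblock det1 mul1r det_mx11 => E; apply/matrixP=> i j; rewrite !ord1 E mxE.
Qed.

Definition tangent_proj X Y :=
  (1%:M - X *m pinvmx X) *m Y *m (1%:M - pinvmx X *m X).

Lemma mulmx_pinvK X : X *m pinvmx X *m X = X.
Proof. exact: mulmxKpV. Qed.

(** For a generalized inverse G of X, expanding (1 - XG) Y (1 - GX) = 0
    displays Y as X (GY) + ((1 - XG) YG) X. *)
Lemma tangent_proj0P X Y :
  reflect (exists P Q, Y = X *m P + Q *m X) (tangent_proj X Y == 0).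
Proof.
rewrite /tangent_proj; move: (pinvmx X) (mulmx_pinvK X) => G XGX.
apply: (iffP eqP) => [|[P [Q ->]]].
  rewrite mulmxBr mulmx1 => /subr0_eq E.
  exists (G *m Y), ((1%:M - X *m G) *m Y *m G).
  by rewrite -[_ *m G *m X]mulmxA -E mulmxBl mul1mx mulmxA addrC subrK.
have KX : (1%:M - X *m G) *m X = 0 by rewrite mulmxBl mul1mx XGX subrr.
have XC : X *m (1%:M - G *m X) = 0 by rewrite mulmxBr mulmx1 mulmxA XGX subrr.
rewrite (mulmxDr (1%:M - X *m G)) (mulmxDl _ _ (1%:M - G *m X)) mulmxA KX !mul0mx add0r.
by rewrite -mulmxA -(mulmxA Q) XC !mulmx0.
Qed.

(** One inclusion differentiates the curve (1 + tQ) X (1 + tP), of rank at most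
    that of X; the other applies the previous lemmas to the rows of 1 - XG and
    the columns of 1 - GX, which are annihilated by X. *)
Lemma tangent_rankE (r : nat) X Y : \rank X = r ->
  tangent_space (rank_variety r) X Y <-> exists P Q, Y = X *m P + Q *m X.
Proof.
move=> rX; split=> [TY|[P [Q ->]]].
  apply/tangent_proj0P/eqP/matrixP => i j; rewrite /tangent_proj.
  move: (pinvmx X) (mulmx_pinvK X) => G XGX.
  have := @tangent_rank_sub r X Y (row i (1%:M - X *m G))
    (col j (1%:M - G *m X)) rX TY.
  rewrite -!row_mul mulmxBl mul1mx XGX subrr row0 => /(_ erefl).
  rewrite {1}colE mulmxA mulmxBr mulmx1 mulmxA XGX subrr mul0mx => /(_ erefl).
  move/matrixP/(_ 0 0); rewrite [X in _ = X]mxE => E.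
  rewrite [RHS]mxE -[RHS]E [LHS]mxE 2![RHS]mxE.
  by apply: eq_bigr => l _; rewrite [col _ _ _ _]mxE.
pose cL := line 1%:M Q; pose cR := line 1%:M P.
have := @tangent_velocity (rank_variety r) (cL *m map_mx polyC X *m cR).
have atM t (A B : 'M_m) : mx_at t (A *m B) = mx_at t A *m mx_at t B.
  by rewrite -(map_mxM (horner_eval t)).
rewrite !atM mx_at_polyC !line_at !scale0r !addr0 mul1mx mulmx1.
have -> : mx_at 0 (map_mx (@deriv F) (cL *m map_mx polyC X *m cR))
   = X *m P + Q *m X.
  have -> : cL *m map_mx polyC X *m cR = map_mx polyC X
     + 'X *: map_mx polyC (X *m P + Q *m X) + ('X * 'X) *: map_mx polyC (Q *m X *m P).
    rewrite /cL /cR /line !map_mx1 !mulmxDl !mulmxDr !mul1mx !mulmx1.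
    rewrite -!(scalemxAl, scalemxAr) !map_mxD !map_mxM scalerDr scalerA.
    by rewrite !addrA.
  move: (X *m P + Q *m X) (Q *m X *m P) => A B.
  apply/matrixP => i j; rewrite !mxE !derivD !derivM !derivX !derivC.
  by rewrite !hornerE /= !addr0.
by apply=> t; rewrite !atM mx_at_polyC /rank_variety /= -rX mxrankM_max3.
Qed.

(** Below the generic rank X + t E stays in the variety for every rank one
    matrix E, and these span all matrices. *)
Lemma tangent_rank_lt (r : nat) X Y :
  (\rank X < r)%N -> tangent_space (rank_variety r) X Y.
Proof.
move=> rX f f0.
have E1 i j : mx_diff f X (delta_mx i j) = 0.
  have := @tangent_velocity (rank_variety r) (line X (delta_mx i j)).
  rewrite line_at scale0r addr0 deriv_line mx_at_polyC.
  apply=> // t; rewrite line_at /rank_variety /=.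
  apply: leq_trans (mxrank_add _ _) _; rewrite -addn1 in rX.
  apply: leq_trans rX; rewrite leq_add2l.
  by apply: leq_trans (mxrank_scale _ _) _; rewrite mxrank_delta.
have -> : mx_diff f X Y = \sum_i \sum_j Y i j * mx_diff f X (delta_mx i j).
  rewrite /mx_diff.
  under [RHS]eq_bigr => i _. under eq_bigr => j _ do rewrite mulr_sumr. over.
  under [RHS]eq_bigr => i _ do rewrite exchange_big.
  rewrite exchange_big; apply: eq_bigr => a _ /=.
  rewrite {1}[Y]matrix_sum_delta !linear_sum /= summxE mulr_sumr.
  apply: eq_bigr => i _; rewrite linear_sum summxE mulr_sumr.
  by apply: eq_bigr => j _; rewrite linearZ mxE mulrCA.
by rewrite big1 // => i _; rewrite big1 // => j _; rewrite E1 mulr0.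
Qed.

(** * Smooth points and critical points *)

Definition tspace X : {vspace 'M[F]_m} :=
  lker (linfun (mulmxr (1%:M - pinvmx X *m X) \o mulmx (1%:M - X *m pinvmx X))).

Lemma mem_tspace X Y : (Y \in tspace X) = (tangent_proj X Y == 0).
Proof. by rewrite memv_ker lfunE. Qed.

Lemma tangent_tspace (r : nat) X : \rank X = r ->
  tangent_space (rank_variety r) X = [set Y | Y \in tspace X].
Proof.
move=> rX; apply/seteqP; split=> Y /=; rewrite mem_tspace.
  by move/(tangent_rankE Y rX)/tangent_proj0P.
by move/tangent_proj0P/(tangent_rankE Y rX).
Qed.

Lemma mxrank_equiv X Z : \rank X = \rank Z ->
  exists L R, [/\ L \in unitmx, R \in unitmx & Z = L *m X *m R].
Proof.
move=> rXZ; exists (col_ebase Z *m invmx (col_ebase X)).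
exists (invmx (row_ebase X) *m row_ebase Z); split.
- by rewrite unitmx_mul unitmx_inv !col_ebase_unit.
- by rewrite unitmx_mul unitmx_inv !row_ebase_unit.
have := mulmx_ebase X.
move: (col_ebase X) (row_ebase X) (col_ebase_unit X) (row_ebase_unit X).
move=> C D uC uD <-; rewrite !mulmxA mulmxKV // mulmxK //.
by rewrite rXZ mulmx_ebase.
Qed.

(** Points of rank exactly r are exchanged by Z = L X R, which carries tangent
    spaces isomorphically, and at points of smaller rank the tangent space is
    as large as possible. *)
Lemma rank_smooth (r : nat) X : \rank X = r -> smooth_point (rank_variety r) X.
Proof.
move=> rX; split; first by rewrite /rank_variety /= rX.
exists (\dim (tspace X)); first by exists (tspace X); rewrite (tangent_tspace rX).
move=> Z e; rewrite /rank_variety /= leq_eqVlt => /orP[/eqP rZ|rZ] [E [TE <-]].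
  have [L [R [uL uR ZE]]] : exists L R, [/\ L \in unitmx, R \in unitmx & Z = L *m X *m R].
    by apply: mxrank_equiv; rewrite rX.
  pose phi : 'End('M[F]_m) := linfun (mulmxr R \o mulmx L).
  have phiE Y : phi Y = L *m Y *m R by rewrite lfunE.
  rewrite -(@limg_dim_eq _ _ _ phi).
    apply: dimvS; apply/subvP => _ /memv_imgP[Y + ->]; rewrite phiE mem_tspace.
    move=> /tangent_proj0P[P [Q ->]].
    suff : [set Y | Y \in E] (L *m (X *m P + Q *m X) *m R) by [].
    rewrite -TE; apply/tangent_rankE => //.
    exists (invmx R *m P *m R), (L *m Q *m invmx L); rewrite ZE.
    rewrite mulmxDr mulmxDl !mulmxA; congr (_ + _).
      by rewrite -(mulmxA _ R) mulmxV // mulmx1.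
    by rewrite -(mulmxA _ (invmx L)) mulVmx // mulmx1.
  apply/eqP; rewrite -subv0; apply/subvP => Y.
  rewrite memv_cap memv_ker phiE memv0 => /andP[_ /eqP Y0].
  by rewrite -(mulKmx uL Y) -(mulmxK uR (L *m Y)) Y0 mul0mx mulmx0.
apply: dimvS; apply/subvP => Y _.
by suff : [set Y | Y \in E] Y by []; rewrite -TE; apply: tangent_rank_lt.
Qed.

(** The tangent space at the standard idempotent of rank r < m misses the last
    diagonal matrix unit, so points with a full tangent space are not smooth. *)
Lemma smooth_rank (r : nat) X :
  (r < m)%N -> smooth_point (rank_variety r) X -> \rank X = r.
Proof.
move=> rm [SX [d [E [TE <-]] dmin]]; apply/eqP; move: SX.
rewrite /rank_variety /= leq_eqVlt => /orP[//|rX]; exfalso.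
pose Z : 'M[F]_m := pid_mx r.
have rZ : \rank Z = r by rewrite rank_pid_mx // ltnW.
have : (\dim E <= \dim (tspace Z))%N.
  apply: (dmin Z); first by rewrite /rank_variety /= rZ.
  by exists (tspace Z); rewrite (tangent_tspace rZ).
have -> : E = fullv.
  apply/eqP; rewrite eqEsubv subvf; apply/subvP => Y _.
  by suff : [set Y | Y \in E] Y by []; rewrite -TE; apply: tangent_rank_lt.
move=> dZ; have /eqP TZ : tspace Z == fullv by rewrite eqEdim subvf.
pose l := Ordinal rm.
have := memvf (delta_mx l l : 'M[F]_m); rewrite -TZ mem_tspace.
move=> /tangent_proj0P[P [Q /matrixP/(_ l l)]]; rewrite !mxE !big1 ?addr0.
- by rewrite !eqxx => /eqP; rewrite oner_eq0.
- by move=> k _; rewrite mxE /=; case: eqP => [->|_]; rewrite ?ltnn mulr0.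
by move=> k _; rewrite mxE /= ltnn andbF mul0r.
Qed.

Lemma mxtrace_nondegenerate n p (A : 'M[F]_(n, p)) :
  (forall B, \tr (A *m B) = 0) -> A = 0.
Proof.
move=> A0; apply/matrixP => i j; rewrite mxE.
have := A0 (delta_mx j i); rewrite /mxtrace (bigD1 i) //= big1 => [|k ki].
  rewrite mxE (bigD1 j) //= big1 => [|l lj]; first by rewrite !mxE !eqxx mulr1 !addr0.
  by rewrite mxE (negPf lj) mulr0.
by rewrite mxE big1 // => l _; rewrite mxE (negPf ki) andbF mulr0.
Qed.

Definition critical_eqs U X := X^T *m (U - X) = 0 /\ (U - X) *m X^T = 0.

(** The matrices XP + QX are orthogonal to U - X exactly when U - X is
    annihilated by the transpose of X on both sides. At r = m every matrix is a
    smooth point, and there r <= rank U is what excludes smaller ranks. *)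
Lemma critical_pointsP U (r : nat) X : (r <= \rank U)%N ->
  critical_points U r X <-> \rank X = r /\ critical_eqs U X.
Proof.
move=> rU; split=> [[sX oX]|[rX [E1 E2]]]; last first.
  split=> [|Y]; first exact: rank_smooth.
  move/(tangent_rankE Y rX) => [P [Q ->]]; rewrite /frob linearD /= mulmxDr.
  rewrite !trmx_mul mxtraceD mulmxA mxtrace_mulC !mulmxA E1 mul0mx.
  by rewrite E2 mul0mx mxtrace0 addr0.
have rX : \rank X = r.
  have [/smooth_rank/(_ sX)//|mr] := ltnP r m.
  case: (sX) => + _; rewrite /rank_variety /= leq_eqVlt => /orP[/eqP//|rX].
  have UX : U - X = 0.
    apply: mxtrace_nondegenerate => B; rewrite -[B]trmxK.
    exact/oX/tangent_rank_lt.
  by move: rX; rewrite -(subr0_eq UX) ltnNge rU.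
split=> //; split; apply: mxtrace_nondegenerate => B.
  rewrite -mulmxA mxtrace_mulC -mulmxA -[B]trmxK -trmx_mul.
  by apply/oX/tangent_rankE => //; exists B^T, 0; rewrite mul0mx addr0.
rewrite -mulmxA -[B]trmxK -trmx_mul.
by apply/oX/tangent_rankE => //; exists 0, B^T; rewrite mulmx0 add0r.
Qed.

End TangentSpace.

(** * Adjugates, and traces of idempotents *)

Section Adjugate.
Variable F : fieldType.

Lemma adj_mulmx_regular (R : idomainType) n (M N : 'M[R]_n) :
  \det M != 0 -> \det N != 0 -> \adj (M *m N) = \adj N *m \adj M.
Proof.
move=> dM dN; have dMN : \det (M *m N) != 0 by rewrite det_mulmx mulf_neq0.
have E : (M *m N) *m \adj (M *m N) = (M *m N) *m (\adj N *m \adj M).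
  rewrite mul_mx_adj -mulmxA (mulmxA N) mul_mx_adj mul_scalar_mx -scalemxAr.
  by rewrite mul_mx_adj det_mulmx scale_scalar_mx mulrC.
have := congr1 (mulmx (\adj (M *m N))) E.
move: (\adj N *m \adj M) => A; rewrite !(mulmxA (\adj (M *m N)) (M *m N)) mul_adj_mx.
rewrite !mul_scalar_mx => /matrixP {}E.
by apply/matrixP => i j; apply: (mulfI dMN); have := E i j; rewrite !mxE.
Qed.

(** Both sides are polynomial in the entries, so it is enough to know the
    identity for M + t and N + t over the polynomials in t, whose determinants
    are nonzero. *)
Lemma adj_mulmx n (M N : 'M[F]_n) : \adj (M *m N) = \adj N *m \adj M.
Proof.
have at0 (A : 'M[F]_n) : map_mx (horner_eval 0) (char_poly_mx (- A)) = A.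
  apply/matrixP => i j; rewrite !mxE /horner_eval !hornerE hornerMn hornerX.
  by rewrite mul0rn opprK add0r.
have reg (A : 'M[F]_n) : \det (char_poly_mx (- A)) != 0.
  exact/monic_neq0/char_poly_monic.
have := adj_mulmx_regular (reg M) (reg N).
by move/(congr1 (map_mx (horner_eval 0))); rewrite map_mxM !map_mx_adj map_mxM !at0.
Qed.

Lemma adj_diag n (d : 'rV[F]_n) :
  \adj (diag_mx d) = diag_mx (\row_i \prod_(j | j != i) d 0 j).
Proof.
apply/matrixP => i j; rewrite !mxE /cofactor; have [<-|nij] := eqVneq i j.
  have -> : row' i (col' i (diag_mx d)) = diag_mx (\row_k d 0 (lift i k)).
    by apply/matrixP => k l; rewrite !mxE (inj_eq lift_inj).
  rewrite det_diag addnn -signr_odd odd_double expr0 mul1r mulr1n.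
  rewrite [RHS](reindex_omap (lift i) (unlift i)) /= => [|k]; last first.
    by case: unliftP => [l ->|->]; rewrite ?eqxx.
  apply: eq_big => k; last by rewrite mxE.
  by rewrite liftK eqxx andbT eq_sym neq_lift.
case: (unliftP j i) nij => [k ->|->]; last by rewrite eqxx.
move=> _; rewrite (expand_det_row _ k) big1 ?mulr0 // => l _.
by rewrite !mxE (negPf (neq_lift _ _)) mul0r.
Qed.

(** In a full rank factorization P = C D, idempotence of P means D C = 1. *)
Lemma mxtrace_idem n (P : 'M[F]_n) : P *m P = P -> \tr P = (\rank P)%:R.
Proof.
move=> PP; have := mulmx_base P.
have LC : pinvmx (col_base P) *m col_base P = 1%:M.
  by rewrite mulVpmx ?col_base_full.
have RR : row_base P *m pinvmx (row_base P) = 1%:M.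
  by rewrite mulmxVp ?row_base_free.
move: (col_base P) (row_base P) (pinvmx (col_base P)) (pinvmx (row_base P)) LC RR.
move: (\rank P) => r C D L R LC DR CD; move: PP; rewrite -{P}CD => PP.
suff DC : D *m C = 1%:M by rewrite mxtrace_mulC DC mxtrace1.
have := congr1 (fun A => L *m A *m R) PP; rewrite !mulmxA LC mul1mx.
by rewrite -!mulmxA DR mulmx1.
Qed.

End Adjugate.

(** * The critical space and orthogonal changes of basis *)

Section CriticalSpace.
Variables (F : numClosedFieldType) (m : nat).
Implicit Types (U S X Y A B : 'M[F]_m).

Lemma critical_spaceP U X :
  critical_space U X <-> X *m U^T = U *m X^T /\ X^T *m U = U^T *m X.
Proof.
split=> [H|[E1 E2] i j]; last by rewrite E1 E2 !subrr mxE.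
split; apply/subr0_eq/matrixP => i j; rewrite [RHS]mxE; first by case: (H i j).
by case: (H i j).
Qed.

Lemma frob_cofactor U X : frob X (cofactor_mx U) = \tr (X *m \adj U).
Proof. by congr (\tr (_ *m _)); apply/matrixP => i j; rewrite !mxE. Qed.

Lemma critical_eqs_space U X : critical_eqs U X -> critical_space U X.
Proof.
case; rewrite mulmxBr mulmxBl => /subr0_eq E1 /subr0_eq E2.
apply/critical_spaceP; split.
  by rewrite -[LHS]trmxK trmx_mul trmxK E2 trmx_mul trmxK.
by rewrite E1 -[RHS]trmxK trmx_mul trmxK E1 trmx_mul trmxK.
Qed.

(** The matrix X U^-1 is idempotent with the rank of X, and the trace of an
    idempotent is its rank. *)
Lemma critical_eqs_unit U X : U \in unitmx -> critical_eqs U X ->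
  frob X (cofactor_mx U) = (\rank X)%:R * \det U.
Proof.
move=> uU crit; have [_ E2] := (critical_spaceP _ _).1 (critical_eqs_space crit).
have [+ _] := crit; rewrite mulmxBr => /subr0_eq E1.
have dU : \det U != 0 by rewrite -unitfE -unitmxE.
have adjU : \adj U = \det U *: invmx U by rewrite /invmx uU scalerA divff // scale1r.
have XV : X *m invmx U = invmx U^T *m X^T.
  have uUT : U^T \in unitmx by rewrite unitmx_tr.
  by rewrite -[LHS](mulKmx uUT) (mulmxA U^T) -E2 mulmxK.
rewrite frob_cofactor adjU -scalemxAr mxtraceZ mxtrace_idem; last first.
  by rewrite {1}XV -mulmxA (mulmxA X^T) -E1 (mulmxA _ _ (invmx U)) mulmxA -XV mulmxKV.
by rewrite mxrankMfree ?row_free_unit ?unitmx_inv // mulrC.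
Qed.

Section Orthogonal.
Variables (A B : 'M[F]_m).
Hypotheses (AA : A *m A^T = 1%:M) (BB : B *m B^T = 1%:M).

Definition sandwich X := A *m X *m B^T.

Lemma sandwich_inj : injective sandwich.
Proof.
have [A' B'] := (mulmx1C AA, mulmx1C BB).
move=> X Y /(congr1 (fun Z => A^T *m Z *m B)); rewrite /sandwich !mulmxA A'.
by rewrite !mul1mx -!mulmxA B' !mulmx1.
Qed.

Lemma sandwichK X : A^T *m sandwich X *m B = X.
Proof.
have [A' B'] := (mulmx1C AA, mulmx1C BB).
by rewrite /sandwich !mulmxA A' mul1mx -mulmxA B' mulmx1.
Qed.

Lemma sandwichVK X : sandwich (A^T *m X *m B) = X.
Proof. by rewrite /sandwich !mulmxA AA mul1mx -mulmxA BB mulmx1. Qed.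

Lemma rank_sandwich X : \rank (sandwich X) = \rank X.
Proof.
apply/eqP; rewrite eqn_leq mxrankM_max3 /=.
by rewrite -{1}(sandwichK X) mxrankM_max3.
Qed.

Lemma sandwich_mull X Y :
  (sandwich X)^T *m sandwich Y = B *m (X^T *m Y) *m B^T.
Proof.
rewrite /sandwich !trmx_mul trmxK !mulmxA -(mulmxA _ A^T) (mulmx1C AA).
by rewrite mulmx1.
Qed.

Lemma sandwich_mulr X Y :
  sandwich X *m (sandwich Y)^T = A *m (X *m Y^T) *m A^T.
Proof.
rewrite /sandwich !trmx_mul trmxK !mulmxA -(mulmxA _ B^T) (mulmx1C BB).
by rewrite mulmx1.
Qed.

Lemma orth_conj_inj (C : 'M[F]_m) X Y :
  C *m C^T = 1%:M -> C *m X *m C^T = C *m Y *m C^T <-> X = Y.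
Proof.
move=> CC; split=> [|->//] /(congr1 (fun Z => C^T *m Z *m C)).
by rewrite !mulmxA (mulmx1C CC) !mul1mx -!mulmxA (mulmx1C CC) !mulmx1.
Qed.

Lemma orth_conj_eq0 (C : 'M[F]_m) X :
  C *m C^T = 1%:M -> C *m X *m C^T = 0 <-> X = 0.
Proof.
by move=> CC; rewrite -(orth_conj_inj X 0 CC) mulmx0 mul0mx.
Qed.

Lemma sandwichB X Y : sandwich X - sandwich Y = sandwich (X - Y).
Proof. by rewrite /sandwich mulmxBr mulmxBl. Qed.

Lemma critical_eqs_sandwich S X :
  critical_eqs (sandwich S) (sandwich X) <-> critical_eqs S X.
Proof.
rewrite /critical_eqs sandwichB sandwich_mull sandwich_mulr.
by rewrite (orth_conj_eq0 _ BB) (orth_conj_eq0 _ AA).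
Qed.

Lemma critical_space_sandwich S X :
  critical_space (sandwich S) (sandwich X) <-> critical_space S X.
Proof.
rewrite !critical_spaceP !sandwich_mull !sandwich_mulr.
by rewrite (orth_conj_inj _ _ BB) (orth_conj_inj _ _ AA).
Qed.

Lemma critical_points_sandwich S (r : nat) X : (r <= \rank S)%N ->
  critical_points (sandwich S) r (sandwich X) <-> critical_points S r X.
Proof.
move=> rS; rewrite !critical_pointsP ?rank_sandwich //.
by rewrite critical_eqs_sandwich.
Qed.

Lemma det_sandwich S : \det (sandwich S) = \det A * \det B * \det S.
Proof. by rewrite !det_mulmx det_tr mulrAC. Qed.

Lemma det_orth_neq0 : \det A * \det B != 0.
Proof.
have h (C : 'M[F]_m) : C *m C^T = 1%:M -> \det C != 0.
  by case/mulmx1_unit; rewrite unitmxE unitfE.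
by rewrite mulf_neq0 ?h.
Qed.

Lemma frob_cofactor_sandwich S X :
  frob (sandwich X) (cofactor_mx (sandwich S)) =
  \det A * \det B * frob X (cofactor_mx S).
Proof.
rewrite !frob_cofactor.
have -> : sandwich X *m \adj (sandwich S)
    = \det B *: (A *m (X *m \adj S) *m \adj A).
  rewrite /sandwich !adj_mulmx -!mulmxA (mulmxA B^T) mul_mx_adj det_tr.
  by rewrite mul_scalar_mx -!scalemxAr.
rewrite mxtraceZ mxtrace_mulC (mulmxA _ A) mul_adj_mx mul_scalar_mx mxtraceZ mulrA.
by rewrite (mulrC (\det B)).
Qed.

Lemma W_sandwich S (r : nat) X :
  W_ (sandwich S) r (sandwich X) <-> W_ S r X.
Proof.
rewrite /W_ /= critical_space_sandwich frob_cofactor_sandwich det_sandwich.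
rewrite [r%:R * _]mulrCA -mulrBr; split=> [] [HX E]; split=> //.
  by apply/eqP; move/eqP: E; rewrite mulf_eq0 (negPf det_orth_neq0).
by rewrite E mulr0.
Qed.

End Orthogonal.
End CriticalSpace.

(** * Blocks of critical points of a diagonal matrix *)

Section Pieces.
Local Close Scope classical_set_scope.
Local Open Scope set_scope.
Variables (F : numClosedFieldType) (m : nat) (s : 'rV[F]_m).
Hypothesis s2_inj : forall i j, s 0 i ^+ 2 = s 0 j ^+ 2 -> s 0 i = s 0 j.
Implicit Types (X Y : 'M[F]_m) (I J : {set 'I_m}).

Let S : 'M[F]_m := diag_mx s.
Definition nonzeros : {set 'I_m} := [set i | s 0 i != 0].

Lemma critical_space_diag X : critical_space S X <->
  forall i j, X i j * s 0 j = s 0 i * X j i /\ X j i * s 0 j = s 0 i * X i j.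
Proof.
rewrite critical_spaceP /S tr_diag_mx !mul_mx_diag !mul_diag_mx.
split=> [[/matrixP E1 /matrixP E2] i j|E].
  by have := E1 i j; have := E2 i j; rewrite !mxE.
by split; apply/matrixP => i j; rewrite !mxE; case: (E i j).
Qed.

(** The two equations at (i, j) give X_ij s_i^2 = X_ij s_j^2. *)
Lemma critical_space_off X i j :
  critical_space S X -> s 0 i != s 0 j -> X i j = 0.
Proof.
move=> /critical_space_diag H; apply: contraNeq => Xij.
have [E1 E2] := H i j; apply/eqP/s2_inj; apply: (mulfI Xij).
by rewrite ![_ ^+ 2]expr2 [RHS]mulrA E1 -[RHS]mulrA E2 mulrC mulrA.
Qed.

Lemma critical_space_sym X i j :
  critical_space S X -> s 0 i = s 0 j -> s 0 i != 0 -> X i j = X j i.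
Proof.
move=> /critical_space_diag H sij si; have [E _] := H i j.
by apply: (mulIf si); rewrite {1}sij E mulrC.
Qed.

Lemma frob_cofactor_diag X :
  frob X (cofactor_mx S) = \sum_i X i i * \prod_(j | j != i) s 0 j.
Proof.
rewrite frob_cofactor adj_diag mul_mx_diag /mxtrace.
by apply: eq_bigr => i _; rewrite !mxE.
Qed.

(** A block of a critical point of S: a solution of the critical equations
    supported on J x J. The rank is recorded so that blocks can be added up to
    a prescribed rank. *)
Definition piece J X n :=
  [/\ forall i j, ~~ ((i \in J) && (j \in J)) -> X i j = 0,
      \rank X = n & critical_eqs S X].

Lemma piece0 J : piece J 0 0.
Proof.
split; first by move=> *; rewrite mxE.
  by rewrite mxrank0.
by split; rewrite trmx0 ?mul0mx ?mulmx0.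
Qed.

Lemma sub_piece I J X n : I \subset J -> piece I X n -> piece J X n.
Proof.
move=> /fintype.subsetP IJ [sX rX cX]; split=> // i j nij; apply: sX.
by apply: contra nij => /andP[/IJ -> /IJ ->].
Qed.

(** Disjoint supports kill all the mixed products in the critical equations and
    make the row spaces independent. *)
Lemma pieceD I J X Y (n p : nat) : disjoint (mem I) (mem J) ->
  piece I X n -> piece J Y p -> piece (I :|: J) (X + Y) (n + p)%N.
Proof.
move=> dIJ [sX rX [X1 X2]] [sY rY [Y1 Y2]].
have dF (K L : {set 'I_m}) : disjoint (mem K) (mem L) ->
    forall k, k \in K -> (k \in L) = false.
  by move=> dKL k; apply: disjointFr.
have XY (A B : 'M[F]_m) (K L : {set 'I_m}) : disjoint (mem K) (mem L) ->
    (forall i j, ~~ ((i \in K) && (j \in K)) -> A i j = 0) ->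
    (forall i j, ~~ ((i \in L) && (j \in L)) -> B i j = 0) ->
    A^T *m B = 0 /\ A *m B^T = 0.
  move=> dKL sA sB; split; apply/matrixP=> i j; rewrite !mxE big1 // => k _.
    rewrite mxE; have [kK|kK] := boolP (k \in K); last first.
      by rewrite sA ?mul0r // (negPf kK).
    by rewrite sB ?mulr0 // (dF _ _ dKL k kK).
  rewrite mxE; have [kK|kK] := boolP (k \in K); last first.
    by rewrite sA ?mul0r // (negPf kK) andbF.
  by rewrite sB ?mulr0 // (dF _ _ dKL k kK) andbF.
have [O1 O2] := XY _ _ _ _ dIJ sX sY.
have dJI := dIJ; rewrite disjoint_sym in dIJ; have [O3 O4] := XY _ _ _ _ dIJ sY sX.
split.
- move=> i j; rewrite !inE => nij; rewrite mxE sX ?sY ?addr0 //.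
    by apply: contra nij => /andP[-> ->]; rewrite !orbT.
  by apply: contra nij => /andP[-> ->].
- (* D projects onto the coordinates of I, so it extracts X from X + Y. *)
  pose D : 'M[F]_m := diag_mx (\row_i (i \in I)%:R).
  have DX : D *m X = X /\ X *m D = X.
    rewrite mul_mx_diag mul_diag_mx; split; apply/matrixP => i j; rewrite !mxE.
      by case iI: (i \in I); rewrite ?mul1r // mul0r sX ?iI.
    by case jI: (j \in I); rewrite ?mulr1 // mulr0 sX ?jI ?andbF.
  have DY : D *m Y = 0 /\ Y *m D = 0.
    rewrite mul_mx_diag mul_diag_mx; split; apply/matrixP => i j; rewrite !mxE.
      by case iI: (i \in I); rewrite ?mul0r // sY ?mulr0 // (dF _ _ dJI i iI).
    by case jI: (j \in I); rewrite ?mulr0 // sY ?mul0r // (dF _ _ dJI j jI) andbF.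
  have XD : (X <= (X + Y)%R)%MS.
    apply/submxP; exists D; rewrite mulmxDr; case: DX => -> _; case: DY => -> _.
    by rewrite addr0.
  have YD : (Y <= (X + Y)%R)%MS.
    apply/submxP; exists (1%:M - D); rewrite mulmxBl mul1mx mulmxDr.
    by case: DX => -> _; case: DY => -> _; rewrite addr0 addrC addKr.
  rewrite -rX -rY -mxrank_disjoint_sum; last first.
    apply/eqP/rowV0P => v; rewrite sub_capmx => /andP[/submxP[x ->] /submxP[y E]].
    by case: DX => _ <-; rewrite mulmxA E -mulmxA; case: DY => _ ->; rewrite mulmx0.
  apply/eqP; rewrite eqn_leq mxrankS ?addmx_sub_adds //= mxrankS //.
  by rewrite addsmx_sub XD.
- move: X1 X2 Y1 Y2; rewrite /critical_eqs !mulmxBr !mulmxBl.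
  move=> /subr0_eq X1 /subr0_eq X2 /subr0_eq Y1 /subr0_eq Y2.
  rewrite linearD /= !mulmxDr !mulmxDl X1 X2 Y1 Y2 O1 O2 O3 O4.
  by rewrite !addr0 !add0r !subrr.
Qed.

(** For X = t Q, both sides of X^T S = X^T X are t^2 Q. *)
Lemma critical_eqs_proj (Q : 'M[F]_m) (t : F) :
  Q^T = Q -> Q *m Q = Q -> Q *m S = t *: Q -> critical_eqs S (t *: Q).
Proof.
move=> QT Q2 QS; have SQ : S *m Q = t *: Q.
  rewrite -[LHS]trmxK trmx_mul QT tr_diag_mx QS -{2}QT.
  by apply/matrixP => i j; rewrite !mxE.
have tQT : (t *: Q)^T = t *: Q.
  by rewrite -{2}QT; apply/matrixP => i j; rewrite !mxE.
split; rewrite tQT ?mulmxBr ?mulmxBl -!scalemxAl -!scalemxAr.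
  by rewrite QS Q2 subrr.
by rewrite SQ Q2 subrr.
Qed.

Lemma piece_line J (v : 'rV[F]_m) (t : F) :
    (forall i, i \notin J -> v 0 i = 0) -> v *m v^T = 1%:M ->
    v *m S = t *: v -> t != 0 ->
  piece J (t *: (v^T *m v)) 1.
Proof.
move=> vJ vv vS t0; have Q2 : (v^T *m v) *m (v^T *m v) = v^T *m v.
  by rewrite mulmxA -(mulmxA _ v) vv mulmx1.
have QT : (v^T *m v)^T = v^T *m v by rewrite trmx_mul trmxK.
have QS : v^T *m v *m S = t *: (v^T *m v) by rewrite -mulmxA vS -scalemxAr.
split.
- move=> i j; rewrite !mxE big_ord1 mxE negb_and => /orP[] /vJ ->.
    by rewrite mul0r mulr0.
  by rewrite !mulr0.
- rewrite mxrank_scale_nz //; apply/eqP.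
  by rewrite -(eqr_nat F) -mxtrace_idem // mxtrace_mulC vv mxtrace1.
by apply: critical_eqs_proj.
Qed.

(** Isotropic rows a and b of the kernel of S make N = a^T b a nonzero solution
    of the critical equations, because N^T N, N N^T, S N^T and N^T S all vanish. *)
Lemma piece_isotropic J (a b : 'rV[F]_m) :
    (forall i, i \notin J -> a 0 i = 0 /\ b 0 i = 0) ->
    a *m a^T = 0 -> b *m b^T = 0 -> a *m S = 0 -> b *m S = 0 ->
    a != 0 -> b != 0 ->
  piece J (a^T *m b) 1.
Proof.
move=> abJ aa bb aS bS a0 b0; split.
- move=> i j; rewrite !mxE big_ord1 mxE negb_and => /orP[] /abJ[ai bi].
    by rewrite ai mul0r.
  by rewrite bi mulr0.
- have r1 (c : 'rV[F]_m) : c != 0 -> \rank c = 1%N.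
    by move=> c0; apply/eqP; rewrite eqn_leq rank_leq_row lt0n mxrank_eq0.
  by rewrite mxrankMfree ?mxrank_tr ?r1 // /row_free r1.
split; rewrite trmx_mul trmxK ?mulmxBr ?mulmxBl.
  by rewrite -mulmxA aS mulmx0 -mulmxA (mulmxA a) aa mul0mx mulmx0 subrr.
rewrite -(mulmxA _ b) (mulmxA b) bb mul0mx mulmx0 mulmxA.
by rewrite -[S *m b^T]trmxK trmx_mul trmxK tr_diag_mx bS trmx0 mul0mx subrr.
Qed.

Definition two_coord i j (x y : F) : 'rV[F]_m :=
  x *: delta_mx 0 i + y *: delta_mx 0 j.

Lemma two_coord_norm i j x y : i != j ->
  two_coord i j x y *m (two_coord i j x y)^T = (x ^+ 2 + y ^+ 2)%:M.
Proof.
move=> nij; rewrite /two_coord linearD !linearZ /= !trmx_delta mulmxDl !mulmxDr.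
rewrite -!scalemxAl -!scalemxAr !mul_delta_mx_cond !eqxx.
have nji := nij; rewrite eq_sym in nji; rewrite (negPf nij) (negPf nji).
rewrite !mulr0n !scaler0 addr0 add0r !scalerA -scalerDl -!expr2 !mulr1n.
by apply/matrixP=> k l; rewrite !ord1 !mxE mulr1.
Qed.

Lemma two_coord_diag i j x y t : s 0 i = t -> s 0 j = t ->
  two_coord i j x y *m S = t *: two_coord i j x y.
Proof.
move=> si sj; rewrite mul_mx_diag; apply/rowP => k; rewrite !mxE /= mulrC mulrDr [RHS]mulrDr.
by congr (_ + _); case: eqP => [->|]; rewrite ?mulr0 ?si ?sj.
Qed.

Lemma two_coord_out i j x y k : k \notin [set i; j] -> two_coord i j x y 0 k = 0.
Proof.
rewrite !inE negb_or => /andP[/negPf ki /negPf kj].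
by rewrite !mxE ki kj !mulr0 addr0.
Qed.

Lemma two_coord_neq0 i j x y : i != j -> x != 0 -> two_coord i j x y != 0.
Proof.
move=> nij x0; apply: contra_neq x0 => /rowP/(_ i).
by rewrite !mxE !eqxx (negPf nij) /= mulr0 addr0 mulr1.
Qed.

Definition coord_sum (l : seq 'I_m) : 'M[F]_m := \sum_(i <- l) s 0 i *: delta_mx i i.

Lemma piece_coord_sum l : uniq l -> {subset l <= nonzeros} ->
  piece [set i in l] (coord_sum l) (size l).
Proof.
elim: l => [|i l IHl] /=; first by rewrite /coord_sum big_nil => _ _; apply: piece0.
case/andP=> il ul lnz; rewrite /coord_sum big_cons set_cons -[(size l).+1]add1n.
have inz : s 0 i != 0 by have := lnz i (mem_head _ _); rewrite inE.
apply: pieceD.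
- by rewrite disjoints1 inE.
- have -> : delta_mx i i = (delta_mx 0 i : 'rV[F]_m)^T *m delta_mx 0 i.
    by rewrite trmx_delta mul_delta_mx.
  apply: piece_line => //.
  + by move=> j; rewrite inE mxE => /negPf ->.
  + by rewrite trmx_delta mul_delta_mx; apply/matrixP=> a b; rewrite !ord1 !mxE.
  + rewrite mul_mx_diag; apply/rowP => k; rewrite !mxE /= mulrC.
    by case: eqP => [->|]; rewrite ?mulr0.
- by apply: IHl => // j jl; apply: lnz; rewrite inE jl orbT.
Qed.

Lemma exists_piece (A : {set 'I_m}) n : A \subset nonzeros -> (n <= #|A|)%N ->
  exists X, piece A X n.
Proof.
move=> Anz nA; exists (coord_sum (take n (enum A))).
have tA : {subset take n (enum A) <= A} by move=> i /mem_take; rewrite mem_enum.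
rewrite -[n in piece _ _ n](@size_takel n _ (enum A)) -?cardE //.
apply: (@sub_piece [set i in take n (enum A)]).
  by apply/fintype.subsetP => i; rewrite inE; apply: tA.
apply: piece_coord_sum; first by rewrite take_uniq ?enum_uniq.
by move=> i /tA; apply: (fintype.subsetP Anz).
Qed.

End Pieces.

(** * Directions of affine and linear spans *)

Section Directions.
Variables (F : fieldType) (V : lmodType F).
Implicit Types (C T : set V) (v : V).

(** The vectors along which T is invariant under translation. They form a
    subspace, whatever T is. *)
Definition direction T v := forall x (c : F), T x -> T (x + c *: v).

Lemma direction0 T : direction T 0.
Proof. by move=> x c; rewrite scaler0 addr0. Qed.

Lemma directionD T v w : direction T v -> direction T w -> direction T (v + w).
Proof. by move=> Tv Tw x c Tx; rewrite scalerDr addrA; apply/Tw/Tv. Qed.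

Lemma directionZ T (a : F) v : direction T v -> direction T (a *: v).
Proof. by move=> Tv x c Tx; rewrite scalerA; apply: Tv. Qed.

Lemma directionB T v w : direction T v -> direction T w -> direction T (v - w).
Proof.
by move=> Tv Tw; rewrite -scaleN1r; apply: directionD => //; apply: directionZ.
Qed.

Lemma direction_sum T (I : Type) (l : seq I) (P : pred I) (f : I -> V) :
  (forall i, P i -> direction T (f i)) -> direction T (\sum_(i <- l | P i) f i).
Proof. by apply: big_ind; [apply: direction0 | apply: directionD]. Qed.

Lemma combination_cons C n (x : 'I_n -> V) (a : 'I_n -> F) y (c : F) :
  (forall i, C (x i)) -> C y -> exists (x' : 'I_n.+1 -> V) (a' : 'I_n.+1 -> F),
  [/\ forall i, C (x' i), \sum_i a' i = c + \sum_i a i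
    & \sum_i a' i *: x' i = c *: y + \sum_i a i *: x i].
Proof.
move=> Cx Cy; exists (fun i => oapp x y (unlift ord0 i)).
exists (fun i => oapp a c (unlift ord0 i)); split.
- by move=> i; case: unliftP => [j _|_] /=.
- rewrite big_ord_recl unlift_none; congr (_ + _).
  by apply: eq_bigr => i _; rewrite liftK.
rewrite big_ord_recl unlift_none; congr (_ + _).
by apply: eq_bigr => i _; rewrite liftK.
Qed.

Lemma affine_span_direction C y z :
  C y -> C z -> direction (affine_span C) (y - z).
Proof.
move=> Cy Cz _ c [n [x [a [Cx a1 ->]]]].
have [x1 [a1' [Cx1 s1 c1]]] := combination_cons a (- c) Cx Cz.
have [x2 [a2 [Cx2 s2 c2]]] := combination_cons a1' c Cx1 Cy.
exists n.+2, x2, a2; split=> //; first by rewrite s2 s1 a1 addNKr.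
by rewrite c2 c1 scaleNr scalerBr addrC addrA.
Qed.

Lemma linear_span_direction C y : C y -> direction (linear_span C) y.
Proof.
move=> Cy _ c [n [x [a [Cx ->]]]].
have [x1 [a1 [Cx1 _ c1]]] := combination_cons a c Cx Cy.
by exists n.+1, x1, a1; rewrite c1 addrC.
Qed.

Lemma linear_span0 C : linear_span C 0.
Proof. by exists 0, (fun=> 0), (fun=> 0); split=> [[]//|]; rewrite big_ord0. Qed.

Lemma sub_affine_span C x : C x -> affine_span C x.
Proof.
move=> Cx; exists 1, (fun=> x), (fun=> 1); split=> //.
  by rewrite big_ord1.
by rewrite big_ord1 scale1r.
Qed.

Lemma affine_span_image (f : {linear V -> V}) C D x :
  (forall y, C y -> D (f y)) -> affine_span C x -> affine_span D (f x).
Proof.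
move=> CD [n [y [a [Cy a1 ->]]]]; exists n, (f \o y), a; split=> //.
  by move=> i; apply: CD.
by rewrite linear_sum; apply: eq_bigr => i _; rewrite linearZ.
Qed.

Lemma linear_span_image (f : {linear V -> V}) C D x :
  (forall y, C y -> D (f y)) -> linear_span C x -> linear_span D (f x).
Proof.
move=> CD [n [y [a [Cy ->]]]]; exists n, (f \o y), a; split.
  by move=> i; apply: CD.
by rewrite linear_sum; apply: eq_bigr => i _; rewrite linearZ.
Qed.

End Directions.

(** * Level sets of a linear form on a subspace *)

Section HyperplaneLevels.
Variables (F : fieldType) (V : vectType F) (E : {vspace V}) (f : {linear V -> F^o}).

Let K : {vspace V} := (E :&: lker (linfun f))%VS.

Lemma mem_level_ker x : (x \in K) = (x \in E) && (f x == 0).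
Proof. by rewrite memv_cap memv_ker lfunE. Qed.

Lemma dim_level_ker w : w \in E -> f w != 0 -> \dim E = (\dim K).+1.
Proof.
move=> wE fw; rewrite -(limg_ker_dim (linfun f) E) -addn1; congr addn.
apply/eqP; rewrite eqn_leq; apply/andP; split.
  by apply: leq_trans (dimvS (subvf _)) _; rewrite dimvf.
rewrite lt0n dimv_eq0; apply: contra fw => /eqP f0.
by rewrite -(lfunE f) -memv0 -f0 memv_img.
Qed.

Lemma affine_hyperplane_level w (c : F) : w \in E -> f w != 0 ->
  is_affine_hyperplane [set x | x \in E] [set x | x \in E /\ f x = c].
Proof.
move=> wE fw; exists E, K, ((c / f w) *: w); split=> //; first exact: capvSl.
- exact: dim_level_ker wE fw.
- exact: memvZ.
have f0 : f ((c / f w) *: w) = c by rewrite linearZ /= -[_ *: _]/(_ * _) divfK.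
apply/seteqP; split=> x /=; rewrite mem_level_ker linearB /= f0 subr_eq0.
  by case=> xE ->; rewrite eqxx andbT memvB // memvZ.
by case/andP=> xE /eqP ->; split=> //; rewrite -[x](subrK ((c / f w) *: w)) memvD // memvZ.
Qed.

Lemma linear_hyperplane_level w : w \in E -> f w != 0 ->
  is_linear_hyperplane [set x | x \in E] [set x | x \in E /\ f x = 0].
Proof.
move=> wE fw; exists E, K; split=> //; first exact: capvSl.
  exact: dim_level_ker wE fw.
apply/seteqP; split=> x /=; rewrite mem_level_ker.
  by case=> -> ->; rewrite eqxx.
by case/andP=> xE /eqP.
Qed.

Lemma affine_span_level (C : set V) (c : F) :
  C `<=` [set x | x \in E /\ f x = c] ->
  affine_span C `<=` [set x | x \in E /\ f x = c].
Proof.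
move=> CW _ [n [x [a [Cx a1 ->]]]]; split.
  by apply: memv_suml => i _; apply: memvZ; case: (CW _ (Cx i)).
rewrite linear_sum -[RHS]mul1r -a1 mulr_suml; apply: eq_bigr => i _.
by rewrite linearZ /=; case: (CW _ (Cx i)) => _ ->.
Qed.

Lemma linear_span_level (C : set V) :
  C `<=` [set x | x \in E /\ f x = 0] ->
  linear_span C `<=` [set x | x \in E /\ f x = 0].
Proof.
move=> CW _ [n [x [a [Cx ->]]]]; split.
  by apply: memv_suml => i _; apply: memvZ; case: (CW _ (Cx i)).
rewrite linear_sum big1 // => i _.
by rewrite linearZ /=; case: (CW _ (Cx i)) => _ ->; rewrite scaler0.
Qed.

End HyperplaneLevels.

(** * The span of the critical points of a diagonal matrix *)

Section DiagonalSpan.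
Variables (F : numClosedFieldType) (m : nat) (s : 'rV[F]_m).
Hypothesis s2_inj : forall i j, s 0 i ^+ 2 = s 0 j ^+ 2 -> s 0 i = s 0 j.
Implicit Types (X Y Z : 'M[F]_m) (J : {set 'I_m}).
Local Close Scope classical_set_scope.
Local Open Scope set_scope.

Let S : 'M[F]_m := diag_mx s.
Let k : nat := #|nonzeros s|.

Lemma diag_coord_sum : S = coord_sum s (enum (nonzeros s)).
Proof.
rewrite /coord_sum big_enum /= big_mkcond; apply/matrixP => i j.
rewrite summxE !mxE (bigD1 i) //= big1 => [|l li].
  rewrite inE addr0; have [->|s0] := eqVneq (s 0 i) 0; rewrite !mxE ?mul0rn //.
  by rewrite eqxx eq_sym mulr_natr.
by case: ifP => _; rewrite !mxE // eq_sym (negPf li) mulr0.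
Qed.

Lemma rank_diag : \rank S = k.
Proof.
have sub : {subset enum (nonzeros s) <= nonzeros s} by move=> i; rewrite mem_enum.
have [_ + _] := piece_coord_sum (enum_uniq (nonzeros s)) sub.
by rewrite -diag_coord_sum /k cardE.
Qed.

Lemma kernel_card : #|~: nonzeros s| = (m - k)%N.
Proof. by rewrite cardsCs finset.setCK card_ord. Qed.

Lemma kernel_other p : (k.+1 < m)%N -> p \notin nonzeros s ->
  exists2 q, q \notin nonzeros s & q != p.
Proof.
move=> km pz; have : (0 < #|~: nonzeros s :\ p|)%N.
  have := cardsD1 p (~: nonzeros s); rewrite kernel_card inE pz add1n => E.
  by move: km; rewrite -subn_gt0 subnS E.
by case/card_gt0P => q; rewrite !inE => /andP[qp qz]; exists q; rewrite ?inE.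
Qed.

Lemma kernel_pair : (k.+1 < m)%N ->
  exists p q, [/\ p \notin nonzeros s, q \notin nonzeros s & p != q].
Proof.
move=> km; have : (0 < #|~: nonzeros s|)%N by rewrite kernel_card subn_gt0 ltnW.
case/card_gt0P => q; rewrite inE => qz; have [p pz pq] := kernel_other km qz.
by exists p, q.
Qed.

Lemma two_coord_kernel p q (x y : F) : p \notin nonzeros s -> q \notin nonzeros s ->
  two_coord p q x y *m S = 0.
Proof.
rewrite !inE !negbK => /eqP p0 /eqP q0.
by rewrite (two_coord_diag x y p0 q0) scale0r.
Qed.

Lemma piece_null p q p' q' (c d : F) :
    p \notin nonzeros s -> q \notin nonzeros s ->
    p' \notin nonzeros s -> q' \notin nonzeros s ->
    p != q -> p' != q' -> c ^+ 2 = -1 -> d ^+ 2 = -1 ->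
  piece s (~: nonzeros s) ((two_coord p q 1 c)^T *m two_coord p' q' 1 d) 1.
Proof.
move=> pz qz pz' qz' pq pq' c2 d2.
have out i j (x y : F) : i \notin nonzeros s -> j \notin nonzeros s ->
    forall l, l \notin ~: nonzeros s -> two_coord i j x y 0 l = 0.
  move=> iz jz l; rewrite inE negbK => lz; apply: two_coord_out.
  by apply: contraL lz; rewrite !inE => /orP[] /eqP ->; move: iz jz; rewrite !inE.
have norm0 (i j : 'I_m) (x : F) : i != j -> x ^+ 2 = -1 ->
    two_coord i j 1 x *m (two_coord i j 1 x)^T = 0.
  move=> ij x2; rewrite two_coord_norm // expr1n x2 subrr.
  by apply/matrixP => a b; rewrite !mxE mul0rn.
apply: piece_isotropic; rewrite ?norm0 ?two_coord_kernel ?two_coord_neq0 ?oner_eq0 //.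
by move=> l lz; rewrite !out.
Qed.

Lemma two_coord_outer i j i' j' (x y z w : F) :
  (two_coord i j x y)^T *m two_coord i' j' z w =
  (x * z) *: delta_mx i i' + (x * w) *: delta_mx i j' +
  ((y * z) *: delta_mx j i' + (y * w) *: delta_mx j j') :> 'M[F]_m.
Proof.
have -> : (two_coord i j x y)^T = x *: delta_mx i 0 + y *: delta_mx j 0.
  by apply/matrixP => a b; rewrite !mxE !ord1 !eqxx !andbT.
rewrite /two_coord mulmxDl !mulmxDr.
by rewrite -!scalemxAl -!scalemxAr !mul_delta_mx !scalerA.
Qed.

Section Rank.
Variable r : nat.
Hypothesis (r0 : (0 < r)%N) (rk : (r <= k)%N).

Lemma piece_critical J Y : piece s J Y r -> critical_points S r Y.
Proof. by case=> _ rY cY; apply/critical_pointsP; rewrite ?rank_diag. Qed.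

(** Two indices having been used for a block of rank one, the remaining rank
    r - 1 is taken from the other nonzero s_l, of which there are k - 2; if
    r = k one unit of rank is missing, and an isotropic block supplies it. *)
Lemma filler i j : i \in nonzeros s -> j \in nonzeros s -> i != j ->
    (r < k)%N || (k.+1 < m)%N ->
  exists Z, piece s (~: [set i; j]) Z r.-1.
Proof.
move=> inz jnz ij H.
have kE : k = #|nonzeros s :\: [set i; j]|.+2.
  rewrite /k -[in LHS](cardsID [set i; j] (nonzeros s)) addnC.
  rewrite (finset.setIidPr _) ?cards2 ?ij ?addn2 //.
  by apply/fintype.subsetP => l; rewrite !inE => /orP[] /eqP ->; move: inz jnz; rewrite !inE.
have sub : nonzeros s :\: [set i; j] \subset nonzeros s by apply: finset.subsetDl.
have subC : nonzeros s :\: [set i; j] \subset ~: [set i; j].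
  by apply/fintype.subsetP => l; rewrite !inE => /andP[].
have [rlt|rge] := ltnP r k.
  have [|Z pZ] := exists_piece (n := r.-1) sub.
    by rewrite -ltnS prednK // -ltnS -kE.
  by exists Z; apply: sub_piece pZ.
move: H; rewrite ltnNge rge /= => km.
have rE : r.-1 = (#|nonzeros s :\: [set i; j]| + 1)%N.
  by have -> : r = k; [apply/eqP; rewrite eqn_leq rk | rewrite kE addn1].
have [Z pZ] := exists_piece sub (leqnn _).
have [p [q [pz qz pq]]] := kernel_pair km.
have pN := piece_null pz qz pz qz pq pq (sqrCi F) (sqrCi F).
have dN : disjoint (mem (nonzeros s :\: [set i; j])) (mem (~: nonzeros s)).
  by apply/pred0P => l /=; rewrite !inE; case: (s 0 l != 0); rewrite ?andbF.
have := pieceD dN pZ pN; rewrite -rE => pW; eexists; apply: sub_piece pW.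
rewrite finset.subUset subC /=; apply/fintype.subsetP => l; rewrite !inE negbK.
by apply: contraTN => /orP[] /eqP ->; move: inz jnz; rewrite !inE.
Qed.

Variable T : set 'M[F]_m.
Hypothesis T_dir : forall Y Z,
  critical_points S r Y -> critical_points S r Z -> direction T (Y - Z).

(** Complete two interchangeable blocks by the same third one. *)
Lemma direction_pieces J Y Y' Z n p : (n + p)%N = r ->
    piece s J Y n -> piece s J Y' n -> piece s (~: J) Z p ->
  direction T (Y - Y').
Proof.
move=> npr pY pY' pZ.
have dJ : disjoint (mem J) (mem (~: J)).
  by apply/pred0P => l /=; rewrite !inE andbN.
have h W : piece s J W n -> piece s (J :|: ~: J) (W + Z) r.
  by move=> pW; rewrite -npr; apply: pieceD.
have := T_dir (piece_critical (h _ pY)) (piece_critical (h _ pY')).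
by rewrite opprD addrACA subrr addr0.
Qed.

Lemma piece_delta J i : i \in nonzeros s -> i \in J ->
  piece s J (s 0 i *: delta_mx i i) 1.
Proof.
move=> inz iJ.
have := @piece_coord_sum _ _ s [:: i] isT; rewrite /coord_sum big_seq1 => H.
apply: sub_piece (H _); first by apply/fintype.subsetP => l; rewrite !inE => /eqP ->.
by move=> l; rewrite inE => /eqP ->.
Qed.

Lemma direction_diag i j : i \in nonzeros s -> j \in nonzeros s ->
    (r < k)%N || (k.+1 < m)%N ->
  direction T (s 0 i *: delta_mx i i - s 0 j *: delta_mx j j).
Proof.
move=> inz jnz H; have [<-|ij] := eqVneq i j; first by rewrite subrr; apply: direction0.
have [Z pZ] := filler inz jnz ij H.
apply: (direction_pieces (n := 1) _ _ _ pZ); first by rewrite add1n prednK.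
  by apply: piece_delta => //; rewrite !inE eqxx ?orbT.
by apply: piece_delta => //; rewrite !inE eqxx ?orbT.
Qed.

(** The projections on the lines of e_i + e_j and e_i - e_j differ by a
    symmetric off-diagonal matrix. *)
Lemma direction_sym i j : i \in nonzeros s -> j \in nonzeros s -> i != j ->
    s 0 i = s 0 j -> (r < k)%N || (k.+1 < m)%N ->
  direction T (delta_mx i j + delta_mx j i).
Proof.
move=> inz jnz ij sij H; have [Z pZ] := filler inz jnz ij H.
have s0 : s 0 i != 0 by move: inz; rewrite inE.
pose c : F := (sqrtC 2)^-1.
have c2 : c ^+ 2 = 2^-1 by rewrite exprVn sqrtCK.
have line x : x ^+ 2 = c ^+ 2 ->
    piece s [set i; j] (s 0 i *: ((two_coord i j c x)^T *m two_coord i j c x)) 1.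
  move=> xc; apply: piece_line => //; first by move=> l; apply: two_coord_out.
    by rewrite two_coord_norm // xc c2 -[2^-1]div1r -splitr.
  by apply: two_coord_diag.
have := direction_pieces (n := 1) _ (line c erefl) (line (- c) (sqrrN c)) pZ.
rewrite add1n prednK // => /(_ erefl).
have -> : s 0 i *: ((two_coord i j c c)^T *m two_coord i j c c)
    - s 0 i *: ((two_coord i j c (- c))^T *m two_coord i j c (- c))
    = (s 0 i * (c ^+ 2 * 2)) *: (delta_mx i j + delta_mx j i).
  by rewrite !two_coord_outer; apply/matrixP => a b; rewrite !mxE; ring.
rewrite c2 mulVf ?pnatr_eq0 // mulr1 => /(directionZ (s 0 i)^-1).
by rewrite scalerA mulVf // scale1r.
Qed.

(** With c, d ranging over the two square roots of -1, the four isotropic blocks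
    (e_p + c e_p')^T (e_q' + d e_q) combine to a multiple of E_pq. *)
Lemma direction_null p q : p \notin nonzeros s -> q \notin nonzeros s -> (k.+1 < m)%N ->
  direction T (delta_mx p q).
Proof.
move=> pz qz km; have [p' pz' pp'] := kernel_other km pz.
have [q' qz' qq'] := kernel_other km qz; rewrite eq_sym in pp'.
have [Z pZ] : exists Z, piece s (nonzeros s) Z r.-1.
  by apply: exists_piece => //; apply: leq_trans (leq_pred r) rk.
have i2 : 'i ^+ 2 = -1 :> F := sqrCi F.
have i2' : (- 'i) ^+ 2 = -1 :> F by rewrite sqrrN.
pose N c d : 'M[F]_m := (two_coord p p' 1 c)^T *m two_coord q' q 1 d.
have D c : c ^+ 2 = -1 -> direction T (N c 'i - N c (- 'i)).
  move=> c2; apply: (direction_pieces (J := ~: nonzeros s) (n := 1) (p := r.-1) (Z := Z)).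
  - by rewrite add1n prednK.
  - exact: piece_null.
  - exact: piece_null.
  - by rewrite finset.setCK.
have i4 : 4 * 'i != 0 :> F by rewrite mulf_neq0 ?neq0Ci ?pnatr_eq0.
suff -> : delta_mx p q = (4 * 'i)^-1 *:
    (N 'i 'i - N 'i (- 'i) + (N (- 'i) 'i - N (- 'i) (- 'i))).
  by apply: directionZ; apply: directionD; apply: D.
apply: (scalerI i4); rewrite scalerA divff // scale1r /N !two_coord_outer.
by apply/matrixP => a b; rewrite !mxE; ring.
Qed.

(** Exchange the block s_i E_ii for an isotropic one, itself a combination of
    the directions of the kernel. *)
Lemma direction_single i : i \in nonzeros s -> (k.+1 < m)%N ->
  direction T (delta_mx i i).
Proof.
move=> inz km; have s0 : s 0 i != 0 by move: inz; rewrite inE.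
have [p [q [pz qz pq]]] := kernel_pair km.
have i2 : 'i ^+ 2 = -1 :> F := sqrCi F.
have pN := piece_null pz qz pz qz pq pq i2 i2.
have sub : nonzeros s :\ i \subset nonzeros s by apply: subD1set.
have [|Z pZ] := exists_piece (n := r.-1) sub.
  by rewrite -ltnS prednK //; apply: leq_trans rk _; rewrite /k (cardsD1 i) inz.
have DN : direction T ((two_coord p q 1 'i)^T *m two_coord p q 1 'i).
  by rewrite two_coord_outer; apply: directionD; apply: directionD; apply: directionZ; apply: direction_null.
have Dd : direction T (s 0 i *: delta_mx i i - (two_coord p q 1 'i)^T *m two_coord p q 1 'i).
  apply: (direction_pieces (J := i |: ~: nonzeros s) (n := 1) (p := r.-1) (Z := Z)).
  - by rewrite add1n prednK.
  - by apply: piece_delta => //; rewrite !inE eqxx ?orbT.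
  - by apply: sub_piece pN; apply: subsetU1.
  apply: sub_piece pZ; apply/fintype.subsetP => l; rewrite !inE.
  by case/andP=> /negPf -> ->.
have := directionZ (s 0 i)^-1 (directionD Dd DN).
by rewrite subrK scalerA mulVf // scale1r.
Qed.

(** An element of the critical space is its diagonal plus off-diagonal terms,
    which the equations of the space pair up symmetrically outside the kernel. *)
Lemma direction_critical_space X : critical_space S X ->
    [\/ (r < k)%N, k = 1%N | (k.+1 < m)%N] ->
    direction T (\sum_i X i i *: delta_mx i i) ->
  direction T X.
Proof.
move=> HX H DX.
pose o i j : 'M[F]_m := if i == j then 0 else X i j *: delta_mx i j.
have XE : X = \sum_i X i i *: delta_mx i i + \sum_i \sum_j o i j.
  rewrite {1}[X]matrix_sum_delta -big_split; apply: eq_bigr => i _ /=.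
  rewrite (bigD1 i) //= [in RHS](bigD1 i) //= /o eqxx add0r; congr (_ + _).
  by apply: eq_bigr => j; rewrite eq_sym => /negPf ->.
rewrite XE; apply: directionD => //.
(* O + O pairs the entries at (i, j) and (j, i). *)
set O := \sum_i _; have -> : O = 2^-1 *: (O + O).
  by rewrite -mulr2n -scaler_nat scalerA mulVf ?scale1r // pnatr_eq0.
apply: directionZ; rewrite {2}/O exchange_big -big_split /=.
apply: direction_sum => i _; rewrite -big_split; apply: direction_sum => j _ /=.
rewrite /o eq_sym; have [_|ij] := eqVneq i j.
  by rewrite addr0; apply: direction0.
have [sij|sij] := eqVneq (s 0 i) (s 0 j); last first.
  rewrite !(critical_space_off s2_inj HX) ?scale0r ?addr0 ?(eq_sym (s 0 j)) //.
  exact: direction0.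
have zij : (i \in nonzeros s) = (j \in nonzeros s) by rewrite !inE sij.
have [inz|inz] := boolP (i \in nonzeros s).
  have si0 : s 0 i != 0 by move: inz; rewrite inE.
  rewrite (critical_space_sym HX sij si0) -scalerDr; apply: directionZ.
  apply: direction_sym; rewrite -?zij //.
  case: H => [->//|k1|->]; last by rewrite orbT.
  have : [set i; j] \subset nonzeros s.
    by apply/fintype.subsetP => l; rewrite !inE => /orP[] /eqP ->; rewrite -?sij.
  by move/subset_leq_card; rewrite cards2 ij -/k k1.
have km : (k.+1 < m)%N.
  have : [set i; j] \subset ~: nonzeros s.
    apply/fintype.subsetP => l; rewrite !inE => /orP[] /eqP ->; rewrite -?sij;
      by move: inz; rewrite inE.
  by move/subset_leq_card; rewrite cards2 ij kernel_card ltn_subRL addn1.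
by apply: directionD; apply: directionZ; apply: direction_null; rewrite -?zij.
Qed.

End Rank.

Lemma det_diag_neq0 : (\det S != 0) = (k == m).
Proof.
rewrite -rank_diag -unitfE -[_ \is a _]/(_ \in unitmx) -row_full_unit.
by [].
Qed.

Lemma critical_W_diag (r : nat) X : \rank X = r -> critical_eqs S X -> W_ S r X.
Proof.
move=> rX cX; have HX := critical_eqs_space cX; split=> //.
apply/eqP; rewrite subr_eq0; apply/eqP.
have [d0|dS] := eqVneq (\det S) 0; last first.
  by rewrite critical_eqs_unit ?rX // unitmxE unitfE.
rewrite d0 mulr0 frob_cofactor_diag big1 // => i _.
have [->|P0] := eqVneq (\prod_(j | j != i) s 0 j) 0; first by rewrite mulr0.
have nz_other j : j != i -> s 0 j != 0 by move=> ji; move/prodf_neq0: P0; apply.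
have si : s 0 i = 0.
  apply/eqP; move/eqP: d0; rewrite det_diag (bigD1 i) //= mulf_eq0 => /orP[//|].
  by rewrite (negPf P0).
suff -> : X i i = 0 by rewrite mul0r.
have [_ /matrixP/(_ i i)] := cX.
rewrite !mxE (bigD1 i) //= big1 => [|j ji].
  by rewrite !mxE si mul0rn sub0r addr0 mulNr => /eqP; rewrite oppr_eq0 mulf_eq0 orbb => /eqP.
by rewrite [X^T _ _]mxE (critical_space_off s2_inj HX) ?mulr0 // si eq_sym nz_other.
Qed.

Lemma W_sub_linear_span (r : nat) X : (0 < r <= k)%N -> \det S = 0 ->
    [\/ (r < k)%N, k = 1%N | (k.+1 < m)%N] ->
  W_ S r X -> linear_span (critical_points S r) X.
Proof.
move=> /andP[r0 rk] d0 H [HX EX].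
have Tdir Y : critical_points S r Y ->
    direction (linear_span (critical_points S r)) Y by apply: linear_span_direction.
have Tdir2 Y Z : critical_points S r Y -> critical_points S r Z ->
    direction (linear_span (critical_points S r)) (Y - Z).
  by move=> CY CZ; apply: directionB; apply: Tdir.
suff DX : direction (linear_span (critical_points S r)) X.
  have := DX _ 1 (linear_span0 (critical_points S r)).
  by rewrite add0r scale1r.
apply: (direction_critical_space r0 rk) => //.
apply: direction_sum => i _.
have [km|km] := boolP (k.+1 < m)%N.
  apply: directionZ; have [inz|inz] := boolP (i \in nonzeros s).
    by apply: (direction_single r0 rk).
  by apply: (direction_null r0 rk).
have [inz|inz] := boolP (i \in nonzeros s); last first.
  suff -> : X i i = 0 by rewrite scale0r; apply: direction0.
  move: EX; rewrite d0 mulr0 subr0 frob_cofactor_diag (bigD1 i) //= [X in _ + X]big1 => [|j ji].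
    move/eqP; rewrite addr0 mulf_eq0 => /orP[/eqP//|/prodf_eq0[j ji sj]].
    have : [set i; j] \subset ~: nonzeros s.
      by apply/fintype.subsetP => l; rewrite !inE => /orP[] /eqP ->; rewrite ?(eqP sj) ?eqxx //; move: inz; rewrite inE.
    move/subset_leq_card; rewrite cards2 eq_sym ji kernel_card ltn_subRL addn1.
    by rewrite (negPf km).
  rewrite (bigD1 i) 1?eq_sym //=; move: inz; rewrite inE negbK => /eqP ->.
  by rewrite mul0r mulr0.
apply: directionZ; have s0 : s 0 i != 0 by move: inz; rewrite inE.
have [rlt|rge] := ltnP r k.
  pose l := take r (enum (nonzeros s)).
  have lnz : {subset l <= nonzeros s} by move=> j /mem_take; rewrite mem_enum.
  have lC : critical_points S r (coord_sum s l).
    have -> : r = size l by rewrite size_takel // -cardE.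
    apply: piece_critical; first by rewrite size_takel // -cardE.
    by apply: piece_coord_sum => //; rewrite take_uniq ?enum_uniq.
  (* Moving each of the r coordinates of l to i gives r s_i E_ii. *)
  have : direction (linear_span (critical_points S r))
      (coord_sum s l + \sum_(j <- l) (s 0 i *: delta_mx i i - s 0 j *: delta_mx j j)).
    apply: directionD; first exact: Tdir.
    rewrite big_seq_cond; apply: direction_sum => j; rewrite andbT => jl.
    by apply: (direction_diag r0 rk) => //; rewrite ?rlt // lnz.
  rewrite sumrB addrC subrK big_const_seq count_predT size_takel -?cardE //.
  rewrite iter_addr_0 -scaler_nat scalerA => /(directionZ (r%:R * s 0 i)^-1).
  by rewrite scalerA mulVf ?scale1r // mulf_neq0 // pnatr_eq0 -lt0n.
case: H => [|k1|]; [by rewrite ltnNge rge | | by rewrite (negPf km)].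
have r1 : r = 1%N by apply/eqP; rewrite eqn_leq r0 -k1 rk.
have : critical_points S r (s 0 i *: delta_mx i i).
  rewrite r1; apply: (@piece_critical _ _ [set i]); first by rewrite k1.
  by apply: piece_delta; rewrite ?inE.
move/Tdir/(directionZ (s 0 i)^-1).
by rewrite scalerA mulVf // scale1r.
Qed.

(** The difference of two points of W has a diagonal y with vanishing sum of
    the y_i / s_i, hence is a combination of the s_i E_ii - s_j E_jj. *)
Lemma W_sub_affine_span (r : nat) X : (0 < r <= k)%N -> \det S != 0 ->
    (r < k)%N \/ k = 1%N ->
  W_ S r X -> affine_span (critical_points S r) X.
Proof.
move=> /andP[r0 rk] dS H [HX EX].
have km : k = m by apply/eqP; rewrite -det_diag_neq0.
have nzT i : s 0 i != 0.
  by move: dS; rewrite det_diag => /prodf_neq0; apply.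
have Tdir Y Z : critical_points S r Y -> critical_points S r Z ->
    direction (affine_span (critical_points S r)) (Y - Z).
  by apply: affine_span_direction.
have [|X0 pX0] := exists_piece (s := s) (A := nonzeros s) (n := r) _ rk; first by [].
have CX0 := piece_critical rk pX0.
have [_ rX0 cX0] := pX0; have [HX0 EX0] := critical_W_diag rX0 cX0.
suff DX : direction (affine_span (critical_points S r)) (X - X0).
  have := DX _ 1 (sub_affine_span CX0).
  by rewrite scale1r addrC subrK.
have HD : critical_space S (X - X0).
  move: HX HX0; rewrite !critical_spaceP => -[E1 E2] [E3 E4].
  by rewrite linearB /= !mulmxBl !mulmxBr E1 E2 E3 E4.
have tD : \sum_i (X - X0) i i / s 0 i = 0.
  have cof i : \prod_(j | j != i) s 0 j = \det S / s 0 i.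
    by rewrite det_diag [in RHS](bigD1 i) //= mulrAC divff ?mul1r.
  move: EX EX0 => /subr0_eq E /subr0_eq E0.
  apply: (mulfI dS); rewrite mulr0 mulr_sumr.
  transitivity (frob X (cofactor_mx S) - frob X0 (cofactor_mx S)); last first.
    by rewrite E E0 subrr.
  rewrite !frob_cofactor_diag -sumrB; apply: eq_bigr => i _.
  by rewrite cof !mxE mulrCA mulrBl.
apply: (direction_critical_space r0 rk) => //.
  by case: H => H; [apply: Or31 | apply: Or32].
have m0 : (0 < m)%N by rewrite -km (leq_trans r0).
pose i0 := Ordinal m0.
have -> : \sum_i (X - X0) i i *: delta_mx i i = \sum_i ((X - X0) i i / s 0 i)
    *: (s 0 i *: delta_mx i i - s 0 i0 *: delta_mx i0 i0) :> 'M[F]_m.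
  under [RHS]eq_bigr => i _ do rewrite scalerBr scalerA divfK //.
  by rewrite sumrB -scaler_suml tD scale0r subr0.
apply: direction_sum => i _; apply: directionZ.
have [->|ii0] := eqVneq i i0; first by rewrite subrr; apply: direction0.
apply: (direction_diag r0 rk) => //; rewrite ?inE //.
case: H => [->//|k1]; have := max_card (mem [set i; i0]).
by rewrite cards2 ii0 card_ord -km k1.
Qed.

End DiagonalSpan.

(** * Singular values of real matrices *)

Section SingularValues.
Variable R : rcfType.

Definition sqnorm n (v : 'rV[R]_n) : R := (v *m v^T) 0 0.

Lemma sqnormE n (v : 'rV[R]_n) : v *m v^T = (sqnorm v)%:M.
Proof. exact: mx11_scalar. Qed.

Lemma sqnorm_ge0 n (v : 'rV[R]_n) : 0 <= sqnorm v.
Proof.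
by rewrite /sqnorm mxE sumr_ge0 // => i _; rewrite mxE -expr2 sqr_ge0.
Qed.

Lemma sqnorm_eq0 n (v : 'rV[R]_n) : (sqnorm v == 0) = (v == 0).
Proof.
apply/eqP/eqP => [|->]; last by rewrite /sqnorm mul0mx mxE.
have v_ge0 i : 0 <= v 0 i * v^T i 0 by rewrite mxE -expr2 sqr_ge0.
rewrite /sqnorm mxE => /(psumr_eq0P (fun i _ => v_ge0 i)) v0.
apply/rowP => i; rewrite mxE; apply/eqP; rewrite -sqrf_eq0 expr2; apply/eqP.
by have := v0 i isT; rewrite mxE.
Qed.

Lemma sqnormZ n (c : R) (v : 'rV[R]_n) : sqnorm (c *: v) = c ^+ 2 * sqnorm v.
Proof.
by rewrite /sqnorm linearZ /= -scalemxAl -scalemxAr scalerA mxE expr2.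
Qed.

Lemma normalize n (v : 'rV[R]_n) : v != 0 -> exists c, sqnorm (c *: v) = 1.
Proof.
rewrite -sqnorm_eq0 => v0; exists (Num.sqrt (sqnorm v))^-1.
by rewrite sqnormZ exprVn sqr_sqrtr ?sqnorm_ge0 // mulVf.
Qed.

(** The complex eigenvalue of a real symmetric matrix is real, since it is the
    quotient of two Hermitian forms. *)
Lemma symmetric_eigenvalue n (M : 'M[R]_n) : (0 < n)%N -> M^T = M ->
  exists a, eigenvalue M a.
Proof.
move=> n0 MT; pose f := real_complex R.
have [a] := eigenvalue_closed (map_mx f M) n0.
move=> ea; have /eigenvalueP[w wM w0] := ea.
pose wc : 'rV[R[i]]_n := map_mx Num.conj w.
have Mc : map_mx Num.conj (map_mx f M) = map_mx f M.
  apply/matrixP => i j; rewrite !mxE; apply/CrealP.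
  by rewrite realE !lecE /= eqxx /= -realE num_real.
have MfT : (map_mx f M)^T = map_mx f M by apply/matrixP=> i j; rewrite -{2}MT !mxE.
have wcM : wc *m map_mx f M = a^* *: wc.
  by rewrite -[in LHS]Mc -map_mxM wM map_mxZ.
have q0 : (w *m wc^T) 0 0 != 0.
  have w_ge0 i : 0 <= w 0 i * wc^T i 0 by rewrite !mxE mul_conjC_ge0.
  apply: contra_neq w0; rewrite mxE => /(psumr_eq0P (fun i _ => w_ge0 i)) H.
  apply/rowP => i; rewrite mxE; apply/eqP; rewrite -normr_eq0 -sqrf_eq0 normCK.
  by apply/eqP; have := H i isT; rewrite !mxE.
have ar : a^* = a.
  apply: (mulIf q0); have : (w *m map_mx f M *m wc^T) 0 0 = a * (w *m wc^T) 0 0.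
    by rewrite wM -scalemxAl mxE.
  move=> <-; rewrite -mulmxA -MfT -trmx_mul wcM.
  have -> : (a^* *: wc)^T = a^* *: wc^T by apply/matrixP => i j; rewrite !mxE.
  by rewrite -scalemxAr [RHS]mxE.
have aRe : a = f (complex.Re a).
  move/CrealP: ar {ea wM wcM}; rewrite realE !lecE; case: a => x y /=.
  by rewrite [0 == y]eq_sym; case/orP => /andP[/eqP -> _].
by exists (complex.Re a); move: ea; rewrite {1}aRe eigenvalue_map.
Qed.

(** The Householder reflection exchanging v and the first basis vector. *)
Lemma orthogonal_row0 n (v : 'rV[R]_n.+1) : sqnorm v = 1 ->
  exists Q : 'M[R]_n.+1, Q *m Q^T = 1%:M /\ row 0 Q = v.
Proof.
move=> v1; pose e : 'rV[R]_n.+1 := delta_mx 0 0; pose w := v - e.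
have [w0|w0] := eqVneq w 0.
  exists 1%:M; rewrite trmx1 mulmx1; split=> //.
  by rewrite row1 -/e; apply/esym/subr0_eq.
pose c := sqnorm w; have c0 : c != 0 by rewrite sqnorm_eq0.
pose P := w^T *m w.
have PT : P^T = P by rewrite trmx_mul trmxK.
have PP : P *m P = c *: P.
  by rewrite /P mulmxA -(mulmxA _ w) sqnormE mul_mx_scalar -scalemxAl.
have eE : (e *m w^T) 0 0 = v 0 0 - 1.
  rewrite -rowE !mxE !eqxx //.
have cE : c = 2 * (1 - v 0 0).
  have vE : (v *m e^T) 0 0 = v 0 0.
    by rewrite trmx_delta -colE mxE.
  have entryB (A B : 'M[R]_1) : (A - B) 0 0 = A 0 0 - B 0 0 by rewrite !mxE.
  rewrite /c /sqnorm {1}/w mulmxBl entryB eE.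
  rewrite /w linearB /= mulmxBr entryB vE -/(sqnorm v) v1.
  by ring.
exists (1%:M - (2 / c) *: P); split.
  have -> : (1%:M - (2 / c) *: P)^T = 1%:M - (2 / c) *: P.
    by rewrite linearB /= trmx1 -{2}PT; congr (_ - _); apply/matrixP=> i j; rewrite !mxE.
  rewrite mulmxBl mul1mx mulmxBr mulmx1.
  rewrite -!scalemxAl -!scalemxAr PP !scalerA.
  have -> : 2 / c * (2 / c) * c = 2 / c + 2 / c by field.
  by rewrite scalerDl opprB addrK subrK.
rewrite rowE -/e mulmxBr mulmx1 -scalemxAr /P mulmxA [e *m w^T]mx11_scalar eE.
rewrite mul_scalar_mx scalerA (_ : 2 / c * (v 0 0 - 1) = -1).
  by rewrite scaleN1r opprK addrC subrK.
have v0 : 1 - v 0 0 != 0 by apply: contra_neq c0 => v0; rewrite cE v0 mulr0.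
by rewrite cE; field.
Qed.

(** A unit eigenvector v of U U^T has an eigenvalue t^2 = |vU|^2; its partner w
    is vU / t if t is nonzero, and otherwise a unit vector killed by U^T, which
    exists because U is singular. *)
Lemma singular_pair n (U : 'M[R]_n.+1) : exists v w (t : R),
  [/\ sqnorm v = 1, sqnorm w = 1, 0 <= t, v *m U = t *: w & w *m U^T = t *: v].
Proof.
have [|l /eigenvalueP[v0 v0M /normalize[c]]] :=
  @symmetric_eigenvalue _ (U *m U^T) isT; first by rewrite trmx_mul trmxK.
set v := c *: v0 => v1.
have vM : v *m U *m U^T = l *: v.
  by rewrite /v -mulmxA -scalemxAl v0M scalerA mulrC -scalerA.
have lE : l = sqnorm (v *m U).
  rewrite /sqnorm trmx_mul mulmxA vM -scalemxAl mxE.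
  by rewrite -/(sqnorm v) v1 mulr1.
have [vU0|vU0] := eqVneq (v *m U) 0.
  have /det0P[w0 w0n w0U] : \det U^T == 0.
    rewrite det_tr; apply/det0P; exists v => //.
    by rewrite -sqnorm_eq0 v1 oner_eq0.
  have [d dw] := normalize w0n.
  by exists v, (d *: w0), 0; rewrite vU0 -scalemxAl w0U scaler0 !scale0r.
pose t := Num.sqrt l.
have l0 : l != 0 by rewrite lE sqnorm_eq0.
have lge : 0 <= l by rewrite lE sqnorm_ge0.
have t2 : t ^+ 2 = l by rewrite sqr_sqrtr.
have t0 : t != 0 by rewrite -sqrf_eq0 t2.
exists v, (t^-1 *: (v *m U)), t; split=> //.
- by rewrite sqnormZ -lE exprVn t2 mulVf.
- exact: sqrtr_ge0.
- by rewrite scalerA divff // scale1r.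
by rewrite -scalemxAl vM scalerA -t2 expr2 mulKf.
Qed.

(** Completing a singular pair to orthogonal bases splits U into t and a smaller
    block. *)
Lemma svd_exists n (U : 'M[R]_n) : exists (A : 'M[R]_n) (s : 'rV[R]_n) (B : 'M[R]_n),
  [/\ A *m A^T = 1%:M, B *m B^T = 1%:M, forall i, 0 <= s 0 i
    & U = A *m diag_mx s *m B^T].
Proof.
elim: n U => [|n IHn] U.
  exists 1%:M, 0, 1%:M; rewrite trmx1 !mulmx1; split=> //; first by case.
  by apply/matrixP; case.
have [v [w [t [v1 w1 t0 vU wU]]]] := singular_pair U.
have [P [PP Pv]] := orthogonal_row0 v1; have [Q [QQ Qw]] := orthogonal_row0 w1.
pose M : 'M[R]_(1 + n) := P *m U *m Q^T.
have /rowP M0 : row 0 M = t *: delta_mx 0 0.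
  by rewrite !row_mul Pv vU -scalemxAl -Qw -row_mul QQ row1.
have /rowP MT0 : row 0 M^T = t *: delta_mx 0 0.
  rewrite !trmx_mul trmxK mulmxA !row_mul Qw wU -scalemxAl -Pv -row_mul PP.
  by rewrite row1.
have -> : U = P^T *m M *m Q.
  by rewrite /M !mulmxA (mulmx1C PP) mul1mx -mulmxA (mulmx1C QQ) mulmx1.
move: M M0 MT0 => M M0 MT0.
have l0 : lshift n (0 : 'I_1) = 0 :> 'I_(1 + n) by apply: val_inj.
have r0 (i : 'I_n) : (rshift 1 i == (0 : 'I_(1 + n))) = false by [].
have ME : M = block_mx t%:M 0 0 (drsubmx M).
  rewrite -[LHS]submxK; congr block_mx; apply/matrixP => i j; rewrite ?ord1.
  - by have := M0 (lshift n 0); rewrite !mxE l0 !eqxx mulr1.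
  - by have := M0 (rshift 1 j); rewrite !mxE l0 r0 andbF mulr0.
  - by have := MT0 (rshift 1 i); rewrite !mxE l0 r0 andbF mulr0.
have [A [s [B [AA BB s0 E]]]] := IHn (drsubmx M).
have blockT (C D : 'M[R]_n) :
    block_mx 1%:M 0 0 C *m (block_mx 1%:M 0 0 D)^T = block_mx 1%:M 0 0 (C *m D^T)
    :> 'M[R]_(1 + n).
  rewrite tr_block_mx trmx1 !trmx0 mulmx_block.
  by rewrite !mul0mx !mulmx0 mul1mx !addr0 add0r.
pose A' : 'M[R]_(1 + n) := block_mx 1%:M 0 0 A.
pose B' : 'M[R]_(1 + n) := block_mx 1%:M 0 0 B.
have AA' : A' *m A'^T = 1%:M by rewrite blockT AA -scalar_mx_block.
have BB' : B' *m B'^T = 1%:M by rewrite blockT BB -scalar_mx_block.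
have D : diag_mx (row_mx t%:M s) = block_mx t%:M 0 0 (diag_mx s) :> 'M[R]_(1 + n).
  rewrite diag_mx_row; congr block_mx.
  by apply/matrixP => i j; rewrite !ord1 !mxE eqxx.
have MAB : M = A' *m diag_mx (row_mx t%:M s) *m B'^T.
  rewrite ME E D /A' /B' tr_block_mx trmx1 !trmx0 !mulmx_block.
  by rewrite !(mulmx0, mul0mx, mulmx1, mul1mx, addr0, add0r).
exists (P^T *m A'), (row_mx t%:M s), (Q^T *m B'); split.
- rewrite trmx_mul trmxK mulmxA -(mulmxA P^T) AA' mulmx1; exact: mulmx1C.
- rewrite trmx_mul trmxK mulmxA -(mulmxA Q^T) BB' mulmx1; exact: mulmx1C.
- by move=> i; rewrite mxE; case: splitP => j _; rewrite // !mxE ord1 mulr1n.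
by rewrite MAB trmx_mul trmxK !mulmxA.
Qed.

End SingularValues.

(** * The hyperplane as a level set of the cofactor form *)

Section CriticalVspace.
Variables (F : numClosedFieldType) (m : nat).
Implicit Types (U X : 'M[F]_m).

Definition skew_mulr U X := X *m U^T - U *m X^T.
Definition skew_mull U X := X^T *m U - U^T *m X.

Fact skew_mulr_linear U : linear (skew_mulr U).
Proof.
move=> a X Y; rewrite /skew_mulr linearP /= mulmxDl mulmxDr -scalemxAl -scalemxAr.
by rewrite scalerBr opprD addrACA.
Qed.

Fact skew_mull_linear U : linear (skew_mull U).
Proof.
move=> a X Y; rewrite /skew_mull linearP /= mulmxDl mulmxDr -scalemxAl -scalemxAr.
by rewrite scalerBr opprD addrACA.
Qed.

HB.instance Definition _ U := GRing.isLinear.Build F _ _ _ (skew_mulr U)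
  (skew_mulr_linear U).
HB.instance Definition _ U := GRing.isLinear.Build F _ _ _ (skew_mull U)
  (skew_mull_linear U).

Definition critical_vspace U : {vspace 'M[F]_m} :=
  (lker (linfun (skew_mulr U)) :&: lker (linfun (skew_mull U)))%VS.

Lemma critical_space_vspace U :
  critical_space U = [set X | X \in critical_vspace U].
Proof.
apply/seteqP; split=> X /=; rewrite memv_cap !memv_ker !lfunE /= !subr_eq0.
  by move/critical_spaceP => [-> ->]; rewrite !eqxx.
by case/andP=> /eqP E1 /eqP E2; apply/critical_spaceP.
Qed.

Definition cofactor_form U : {linear 'M[F]_m -> F^o} :=
  mxtrace \o mulmxr (cofactor_mx U)^T.

Lemma W_level U (r : nat) : W_ U r =
  [set X | X \in critical_vspace U /\ cofactor_form U X = r%:R * \det U].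
Proof.
apply/seteqP; split=> X; rewrite /W_ critical_space_vspace /=.
  by case=> HX /subr0_eq.
by case=> HX EX; split=> //; rewrite /frob EX subrr.
Qed.

End CriticalVspace.

(** * Critical points of a matrix with distinct singular values *)

Section DiagonalCount.
Variables (F : numClosedFieldType) (m : nat) (s : 'rV[F]_m).
Hypothesis s2_inj : forall i j, s 0 i ^+ 2 = s 0 j ^+ 2 -> s 0 i = s 0 j.
Local Close Scope classical_set_scope.
Local Open Scope set_scope.

Let S : 'M[F]_m := diag_mx s.
Let k : nat := #|nonzeros s|.

Lemma kernel_le1 p q : (m <= k.+1)%N -> p \notin nonzeros s -> q \notin nonzeros s -> p = q.
Proof.
move=> mk pz qz; apply/eqP; apply: contraTT mk => pq; rewrite -ltnNge.
have : [set p; q] \subset ~: nonzeros s.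
  by apply/fintype.subsetP => l; rewrite finset.in_setC !inE => /orP[] /eqP ->;
    [move: pz | move: qz]; rewrite inE.
by move/subset_leq_card; rewrite cards2 pq kernel_card ltn_subRL addn1.
Qed.

(** If at most one s_p vanishes, the coefficient of X_pp in <X, C(S)> is the
    product of the other s_j, which is nonzero. *)
Lemma cofactor_form_neq0 : (0 < m)%N -> (m <= k.+1)%N ->
  exists2 X, critical_space S X & frob X (cofactor_mx S) != 0.
Proof.
move=> m0 mk.
have [p pP] : exists p, forall j, j != p -> s 0 j != 0.
  have [/existsP[p pz]|] := boolP [exists p, p \notin nonzeros s].
    exists p => j jp; apply: contra_neqT jp; rewrite negbK => sj.
    by apply: kernel_le1 => //; rewrite inE negbK.
  rewrite negb_exists => /forallP nz_all; exists (Ordinal m0) => j _.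
  by have := nz_all j; rewrite negbK inE.
exists (delta_mx p p).
  apply/critical_space_diag => i j; rewrite !mxE.
  have [->|_] := eqVneq i p; have [->|_] := eqVneq j p;
    by rewrite /= ?mulr1n ?mul0r ?mulr0 // mul1r mulr1.
rewrite frob_cofactor_diag (bigD1 p) //= [X in _ + X]big1 => [|i ip].
  by rewrite mxE !eqxx mul1r addr0; apply/prodf_neq0.
by rewrite mxE (negPf ip) mul0r.
Qed.

Definition coordinate_point (I : {set 'I_m}) : 'M[F]_m := coord_sum s (enum I).

Lemma coordinate_pointE I i j :
  coordinate_point I i j = if (i == j) && (i \in I) then s 0 i else 0.
Proof.
rewrite /coordinate_point /coord_sum big_enum /= big_mkcond summxE (bigD1 i) //=.
rewrite big1 ?addr0 => [|l li].
  case: (i \in I); rewrite !mxE ?andbF // eqxx eq_sym andbT.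
  by case: eqP; rewrite ?mulr1 ?mulr0.
by case: ifP => _; rewrite !mxE // eq_sym (negPf li) mulr0.
Qed.

Lemma coordinate_point_inj :
  {in [pred I : {set 'I_m} | I \subset nonzeros s] &, injective coordinate_point}.
Proof.
have mem (I : {set 'I_m}) i : I \subset nonzeros s ->
    (i \in I) = (coordinate_point I i i != 0).
  move=> /fintype.subsetP sub; rewrite coordinate_pointE eqxx /=.
  by case: ifP => [/sub|]; rewrite ?inE ?eqxx.
by move=> I J /= sI sJ E; apply/setP => i; rewrite !mem // E.
Qed.

Section Count.
Variable r : nat.
Hypotheses (r_range : (0 < r <= k)%N) (mk : (m <= k.+1)%N).
Hypothesis s_inj : forall i j, s 0 i != 0 -> s 0 i = s 0 j -> i = j.

(** With distinct nonzero singular values and at most one zero, a critical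
    point X is diagonal, and the critical equations read x^2 = s x entrywise. *)
Lemma critical_points_diag X : critical_points S r X <->
  exists I : {set 'I_m}, [/\ I \subset nonzeros s, #|I| = r & X = coordinate_point I].
Proof.
have /andP[r0 rk] := r_range.
have pt (I : {set 'I_m}) : I \subset nonzeros s -> piece s [set i in enum I] (coordinate_point I) #|I|.
  move=> /fintype.subsetP sub; rewrite cardE; apply: piece_coord_sum (enum_uniq _) _.
  by move=> i; rewrite mem_enum; apply: sub.
split=> [|[I [sI cI ->]]]; last first.
  by apply: (piece_critical rk); have := pt I sI; rewrite cI; apply.
move/critical_pointsP; rewrite rank_diag => /(_ rk) [rX cX].
have HX := critical_eqs_space cX.
have off i j : i != j -> X i j = 0.
  move=> ij; have [sij|] := eqVneq (s 0 i) (s 0 j); last exact: critical_space_off.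
  case/eqP: ij; have [si|si] := eqVneq (s 0 i) 0; last exact: s_inj.
  by apply: kernel_le1 => //; rewrite inE negbK -?sij si.
have on i : X i i = 0 \/ X i i = s 0 i.
  have [_ /matrixP/(_ i i)] := cX; rewrite !mxE (bigD1 i) //= big1 => [|j ji].
    rewrite !mxE eqxx addr0 => /eqP; rewrite mulf_eq0 subr_eq0.
    by case/orP => /eqP; [right | left].
  by rewrite [X^T _ _]mxE off ?mulr0 // eq_sym.
pose I := [set i | X i i != 0].
have sI : I \subset nonzeros s.
  by apply/fintype.subsetP => i; rewrite !inE; case: (on i) => -> //; rewrite eqxx.
have XI : X = coordinate_point I.
  apply/matrixP => i j; rewrite coordinate_pointE inE.
  have [<-|ij] := eqVneq i j; last exact: off.
  by case: (on i) => ->; rewrite ?eqxx //=; case: eqP.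
exists I; split=> //.
by have [_ + _] := pt I sI; rewrite -XI rX => ->.
Qed.

Lemma card_critical_points_diag : (critical_points S r #= `I_('C(k, r)))%card.
Proof.
pose G := [set I : {set 'I_m} | I \subset nonzeros s & #|I| == r].
pose g n := coordinate_point (nth finset.set0 (enum G) n).
have sG : size (enum G) = 'C(k, r) by rewrite -cardE cards_draws.
have inG n : (n < 'C(k, r))%N -> nth finset.set0 (enum G) n \in G.
  by rewrite -sG => nG; rewrite -mem_enum mem_nth.
have -> : critical_points S r = (image `I_('C(k, r)) g)%classic.
  apply/seteqP; split=> X /=.
    move/critical_points_diag => [I [sI cI ->]].
    have IG : I \in enum G by rewrite mem_enum inE sI cI eqxx.
    by exists (index I (enum G)); rewrite /= -?sG ?index_mem // /g nth_index.
  case=> n /= /inG; rewrite inE => /andP[sI /eqP cI] <-.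
  by apply/critical_points_diag; exists (nth finset.set0 (enum G) n).
apply: inj_card_eq => n1 n2; rewrite !inE /= => l1 l2 /coordinate_point_inj E.
apply/eqP; rewrite -(nth_uniq finset.set0 _ _ (enum_uniq G)) ?sG //; apply/eqP.
by apply: E; rewrite inE; [move: (inG _ l1) | move: (inG _ l2)];
  rewrite inE => /andP[].
Qed.

End Count.
End DiagonalCount.

(** * From diagonal matrices to arbitrary ones *)

Section SingularValueDecomposition.
Variables (F : numClosedFieldType) (m : nat) (s : 'rV[F]_m) (A B : 'M[F]_m).
Hypothesis s2_inj : forall i j, s 0 i ^+ 2 = s 0 j ^+ 2 -> s 0 i = s 0 j.
Hypotheses (AA : A *m A^T = 1%:M) (BB : B *m B^T = 1%:M).

Let S : 'M[F]_m := diag_mx s.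
Let U := sandwich A B S.
Let k : nat := #|nonzeros s|.

Lemma svd_rank : \rank U = k.
Proof. by rewrite (rank_sandwich AA BB) rank_diag. Qed.

Lemma svd_det_neq0 : (\det U != 0) = (\det S != 0).
Proof.
by rewrite (det_sandwich) mulf_eq0 (negPf (det_orth_neq0 AA BB)).
Qed.

Lemma svd_det_eq0 : \det U = 0 -> \det S = 0.
Proof. by move=> U0; apply/eqP/negPn; rewrite -svd_det_neq0 U0 eqxx. Qed.

Lemma svd_critical_sub_W (r : nat) : (r <= k)%N ->
  critical_points U r `<=` W_ U r.
Proof.
move=> rk X; rewrite -(sandwichVK AA BB X).
move/(critical_points_sandwich AA BB) => /(_ _)/critical_pointsP H.
apply/(W_sandwich AA BB); have [||rX cX] := H; rewrite ?rank_diag //.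
exact: critical_W_diag.
Qed.

Lemma svd_card (r : nat) : (0 < r <= k)%N -> (m <= k.+1)%N ->
    (forall i j, s 0 i != 0 -> s 0 i = s 0 j -> i = j) ->
  (critical_points U r #= `I_('C(k, r)))%card.
Proof.
move=> rk mk s_inj; have rS : (r <= \rank S)%N by rewrite rank_diag; case/andP: rk.
have -> : critical_points U r = sandwich A B @` critical_points S r.
  apply/seteqP; split=> X; last first.
    by case=> Y CY <-; apply/(critical_points_sandwich AA BB).
  rewrite -(sandwichVK AA BB X) => /(critical_points_sandwich AA BB _ rS) CX.
  by eexists; first exact: CX.
apply: card_eq_trans (card_critical_points_diag s2_inj rk mk s_inj).
by apply: inj_card_eq => X Y _ _; apply: sandwich_inj.
Qed.

HB.instance Definition _ := GRing.Linear.copy (sandwich A B)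
  (mulmxr B^T \o mulmx A).

Lemma svd_linear_span (r : nat) : (0 < r <= k)%N -> \det U = 0 ->
    [\/ (r < k)%N, k = 1%N | (k.+1 < m)%N] ->
  linear_span (critical_points U r) = W_ U r.
Proof.
move=> rk U0 H; have rS : (r <= \rank S)%N by rewrite rank_diag; case/andP: rk.
apply/seteqP; split.
  have := @svd_critical_sub_W r; rewrite W_level U0 mulr0 => sub.
  by apply: linear_span_level; apply: sub; case/andP: rk.
move=> X; rewrite -(sandwichVK AA BB X) => /(W_sandwich AA BB) WX.
apply: linear_span_image (W_sub_linear_span s2_inj rk (svd_det_eq0 U0) H WX).
by move=> Y CY; apply/critical_points_sandwich.
Qed.

Lemma svd_affine_span (r : nat) : (0 < r <= k)%N -> \det U != 0 ->
    (r < k)%N \/ k = 1%N ->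
  affine_span (critical_points U r) = W_ U r.
Proof.
move=> rk U0 H; have rS : (r <= \rank S)%N by rewrite rank_diag; case/andP: rk.
apply/seteqP; split.
  have := @svd_critical_sub_W r; rewrite W_level => sub.
  by apply: affine_span_level; apply: sub; case/andP: rk.
rewrite svd_det_neq0 in U0.
move=> X; rewrite -(sandwichVK AA BB X) => /(W_sandwich AA BB) WX.
apply: affine_span_image (W_sub_affine_span s2_inj rk U0 H WX).
by move=> Y CY; apply/critical_points_sandwich.
Qed.

Lemma svd_cofactor_form : (0 < m)%N -> (m <= k.+1)%N ->
  exists2 X, X \in critical_vspace U & cofactor_form U X != 0.
Proof.
move=> m0 mk; have [X HX X0] := cofactor_form_neq0 m0 mk.
exists (sandwich A B X).
  suff : [set X | X \in critical_vspace U] (sandwich A B X) by [].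
  by rewrite -critical_space_vspace; apply/(critical_space_sandwich AA BB).
rewrite -[cofactor_form U _]/(frob _ (cofactor_mx U)) frob_cofactor_sandwich.
by rewrite mulf_neq0 ?(det_orth_neq0 AA BB).
Qed.

Lemma svd_affine_hyperplane (r : nat) : (0 < m)%N -> (m <= k.+1)%N ->
  is_affine_hyperplane (critical_space U) (W_ U r).
Proof.
move=> m0 mk; have [X HX X0] := svd_cofactor_form m0 mk.
rewrite critical_space_vspace W_level.
exact: affine_hyperplane_level HX X0.
Qed.

Lemma svd_linear_hyperplane (r : nat) : (0 < m)%N -> (m <= k.+1)%N ->
  \det U = 0 -> is_linear_hyperplane (critical_space U) (W_ U r).
Proof.
move=> m0 mk U0; have [X HX X0] := svd_cofactor_form m0 mk.
rewrite critical_space_vspace W_level U0 mulr0.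
exact: linear_hyperplane_level HX X0.
Qed.

End SingularValueDecomposition.

Section ParallelLevels.
Variables (F : numClosedFieldType) (m : nat) (U : 'M[F]_m).

(** The level of U itself is m det U, so adding multiples of U moves between
    the levels W_r. *)
Lemma cofactor_form_self : frob U (cofactor_mx U) = m%:R * \det U.
Proof. by rewrite frob_cofactor mul_mx_adj mxtrace_scalar mulr_natl. Qed.

Lemma W_shift (r q : nat) X : (0 < m)%N -> W_ U r X ->
  W_ U q (X + ((q%:R - r%:R) / m%:R) *: U).
Proof.
move=> m0; rewrite !W_level => -[HX EX]; split.
  rewrite memvD ?memvZ //.
  suff : [set X | X \in critical_vspace U] U by [].
  by rewrite -critical_space_vspace; apply/critical_spaceP.
have formZ (a : F) : cofactor_form U (a *: U) = a * frob U (cofactor_mx U).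
  by rewrite linearZ.
rewrite linearD EX formZ cofactor_form_self mulrA divfK ?pnatr_eq0 -?lt0n //.
by rewrite -mulrDl addrC subrK.
Qed.

Lemma W_parallel (r q : nat) : (0 < m)%N -> parallel (W_ U r) (W_ U q).
Proof.
move=> m0; exists (((q%:R - r%:R) / m%:R) *: U); apply/seteqP; split=> X.
  move=> /(W_shift r m0) WX; eexists; first exact: WX.
  rewrite /= -addrA -scalerDl -mulrDl.
  have -> : r%:R - q%:R + (q%:R - r%:R) = 0 :> F by rewrite addrA subrK subrr.
  by rewrite mul0r scale0r addr0.
by case=> Y WY <-; apply: W_shift.
Qed.

Lemma W_disjoint (r q : nat) : \det U != 0 -> r <> q -> W_ U r `&` W_ U q = set0.
Proof.
move=> dU rq; rewrite -subset0 => X [[_ /subr0_eq E1] [_ /subr0_eq E2]].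
apply: rq; apply/eqP; rewrite -(eqr_nat F); apply/eqP.
by apply: (mulIf dU); rewrite -E1 -E2.
Qed.

End ParallelLevels.

Lemma complexify_svd (R : realType) m (U A : 'M[R]_m) s B : is_svd U A s B ->
  let sC : 'rV[R[i]]_m := map_mx (real_complex R) s in
  [/\ complexify A *m (complexify A)^T = 1%:M,
      complexify B *m (complexify B)^T = 1%:M,
      forall i j, sC 0 i ^+ 2 = sC 0 j ^+ 2 -> sC 0 i = sC 0 j
    & complexify U = sandwich (complexify A) (complexify B) (diag_mx sC)].
Proof.
have tr (M : 'M[R]_m) : (complexify M)^T = complexify M^T.
  by apply/matrixP => i j; rewrite !mxE.
case=> AA BB s0 UE sC; rewrite /sandwich !tr /complexify; split.
- by rewrite -map_mxM AA map_mx1.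
- by rewrite -map_mxM BB map_mx1.
- move=> i j; rewrite !mxE -!rmorphXn => /complexI/eqP.
  by rewrite eqrXn2 // => /eqP ->.
by rewrite UE !map_mxM map_diag_mx.
Qed.

Theorem proposition4p12 (R : realType) (m k : nat) (U : 'M[R]_m)
    (rkU : \rank U = k) :
  let UC : 'M[R[i]]_m := complexify U in
  [/\ forall r : nat, (1 <= r <= k)%N ->
        [/\ (m <= k.+1)%N -> distinct_nonzero_singular_values U ->
              (critical_points UC r #= `I_('C(k, r)))%card,
            critical_points UC r `<=` W_ UC r,
            W_ UC r `<=` critical_space UC,
            (m <= k.+1)%N -> is_affine_hyperplane (critical_space UC) (W_ UC r)
          & (\det U != 0 -> (r < k)%N \/ k = 1%N ->
               affine_span (critical_points UC r) = W_ UC r) /\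
            (\det U = 0 -> [\/ (r < k)%N, k = 1%N | (k.+1 < m)%N] ->
               linear_span (critical_points UC r) = W_ UC r)],
      \det U != 0 ->
        (forall r : nat, (1 <= r <= m)%N ->
           is_affine_hyperplane (critical_space UC) (W_ UC r)) /\
        (forall r s : nat, (1 <= r <= m)%N -> (1 <= s <= m)%N ->
           parallel (W_ UC r) (W_ UC s) /\
           (r <> s -> W_ UC r `&` W_ UC s = set0))
    & \det U = 0 ->
        forall r : nat, (1 <= r <= k)%N ->
          ((m <= k.+1)%N ->
             is_linear_hyperplane (critical_space UC) (W_ UC r)) /\
          W_ UC r = [set X | critical_space UC X /\
                            frob X (cofactor_mx UC) = 0]].
Proof.
move=> UC.
have rUC : \rank UC = k by rewrite mxrank_map.
have dUC : (\det UC == 0) = (\det U == 0) by rewrite det_map_mx fmorph_eq0.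
have km : (k <= m)%N by rewrite -rkU rank_leq_row.
have [A [s [B svdU]]] := svd_exists U.
have [AA BB s2_inj UE] := complexify_svd svdU.
have kE : #|nonzeros (map_mx (real_complex R) s)| = k.
  by rewrite -rUC /UC UE svd_rank.
have kdet : \det U != 0 -> k = m.
  move=> dU; apply/eqP; rewrite -rkU -[_ == _]/(row_free U) row_free_unit.
  by rewrite unitmxE unitfE.
have hyper r : (0 < m)%N -> (m <= k.+1)%N ->
    is_affine_hyperplane (critical_space UC) (W_ UC r).
  by move=> m0 mk; rewrite /UC UE; apply: svd_affine_hyperplane => //; rewrite kE.
split.
- move=> r rk; have /andP[r0 rk'] := rk; have m0 : (0 < m)%N.
    exact: leq_trans r0 (leq_trans rk' km).
  split.
  + move=> mk [A1 [s1 [B1 [svd1 s1_inj]]]].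
    have [AA1 BB1 s12_inj UE1] := complexify_svd svd1.
    have kE1 : #|nonzeros (map_mx (real_complex R) s1)| = k.
      by rewrite -rUC /UC UE1 svd_rank.
    rewrite -kE1 /UC UE1; apply: svd_card; rewrite ?kE1 //.
    move=> i j; rewrite !mxE fmorph_eq0 => si /complexI.
    exact: s1_inj.
  + by rewrite /UC UE; apply: svd_critical_sub_W => //; rewrite kE.
  + by move=> X [].
  + exact: hyper.
  split=> dU H.
    rewrite /UC UE; apply: svd_affine_span; rewrite ?kE // -UE -/UC.
    by rewrite dUC.
  rewrite /UC UE; apply: svd_linear_span; rewrite ?kE // -UE -/UC.
  by apply/eqP; rewrite dUC dU.
- move=> dU; have mE := kdet dU; split=> [r /andP[r0 rm]|r q /andP[r0 rm] _].
    by apply: hyper; rewrite ?mE // (leq_trans r0).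
  split; first by apply: W_parallel; apply: leq_trans rm.
  by apply: W_disjoint; rewrite dUC.
move=> dU r /andP[r0 rk].
have dUC0 : \det UC = 0 by apply/eqP; rewrite dUC dU.
split; last first.
  by apply/seteqP; split=> X; rewrite /W_ /= dUC0 mulr0 subr0.
move=> mk; rewrite /UC UE; apply: svd_linear_hyperplane; rewrite ?kE // -?UE //.
exact: leq_trans r0 (leq_trans rk km).
Qed.
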